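(* Let $(V,m)$ be a cyclic involutive $A_\infty$-algebra over $k$ with a non-degenerate symmetric bilinear form of degree $d$. Then there are isomorphisms of complexes $$\Sigma^{d+1}\mathrm{CD}^\bullet_+(V)\cong\mathrm{Der}^{\mathrm{cycl}}_+(\widehat T\Sigma^{-1}V^* ),\qquad \Sigma^{d+1}\mathrm{CD}^\bullet_-(V)\cong\mathrm{Der}^{\mathrm{cycl}}_-(\widehat T\Sigma^{-1}V^* ),$$ where $\mathrm{Der}^{\mathrm{cycl}}_+(\widehat T\Sigma^{-1}V^* )$ and $\mathrm{Der}^{\mathrm{cycl}}_-(\widehat T\Sigma^{-1}V^* )$ are each equipped with the differential $d(\xi)=[m,\xi]$.
   Context: **Graded spaces.** $k$ is a field of characteristic zero. Graded vector spaces are $\mathbb Z$-graded over $k$ (cohomological grading) with the Koszul sign rule; $|x|$ is the degree of $x$. $\Sigma k$ is $k$ in degree $-1$, $\Sigma^{-1}k$ is $k$ in degree $1$, and $\Sigma^{n}V=\Sigma^n k\otimes V$. A formal graded vector space is an inverse limit of finite dimensional graded vector spaces with the inverse limit topology; all maps between formal spaces are continuous and tensor products of formal spaces are completed. For a (discrete) graded space $V=\varinjlim V_i$, $V_i$ finite dimensional, $V^*=\varprojlim \underline{\mathrm{Hom}}(V_i,k)$ is formal. For $W$ formal, $\widehat TW=\prod_{n\ge0}W^{\otimes n}$ and $\widehat T_{\ge 1}W=\prod_{n\ge1}W^{\otimes n}$. **Derivations.** A graded derivation is a homogeneous linear map $f$ with $f(xy)=f(x)y+(-1)^{|f||x|}xf(y)$;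 $\mathrm{Der}(A)$ is the graded Lie algebra they span, with the commutator bracket (continuous derivations when $A$ is formal). A derivation $\xi$ of $\widehat T\Sigma^{-1}V^*$ is determined by its components $\xi_n\colon\Sigma^{-1}V^*\to(\Sigma^{-1}V^* )^{\otimes n}$, equivalently (dualizing and desuspending, with Koszul signs) by maps $\hat\xi_n\colon V^{\otimes n}\to V$. $\mathrm{Der}(\widehat T_{\ge1}\Sigma^{-1}V^* )\subset\mathrm{Der}(\widehat T\Sigma^{-1}V^* )$ consists of those with $\xi_0=0$. **Involutions.** An involution on a graded space $V$ is a degree-preserving linear map $v\mapsto v^*$ with $(v^* )^*=v$. Suspensions inherit it, and $V^*$ has the involution $\phi^*(v)=-\phi(v^* )$ (note the sign). If $W$ has an involution, $W^{\otimes n}$ has the involution $(w_1\otimes\dots\otimes w_n)^*=(-1)^{\epsilon}w_n^*\otimes\dots\otimes w_1^*$, $\epsilon=\sum_{i<j}|w_i||w_j|$; so $\widehat T\Sigma^{-1}V^*$ has an involution. $\mathrm{Der}(\widehat T\Sigma^{-1}V^* )$ has the involution $\xi^*(x)=\xi(x^* )^*$, with $\pm1$-eigenspaces $\mathrm{Der}_\pm(\widehat T\Sigma^{-1}V^* )$. **Cyclic involutive $A_\infty$-algebras.** Let $V$ be a graded space with an involution and a symmetric bilinear form $\langle-,-\rangle\colon V\otimes V\to\Sigma^dk$ (of degree $d$) with $\langle x^*,y^*\rangle=\langle x,y\rangle$. A derivation $\xi$ is cyclic if for all $n$ $$\langle\hat\xi_n(x_1,\dots,x_n),x_{n+1}\rangle=(-1)^{\epsilon}(-1)^n\langle\hat\xi_n(x_{n+1},x_1,\dots,x_{n-1}),x_n\rangle,\quad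 \epsilon=|x_{n+1}|\sum_{i=1}^n|x_i|.$$ $\mathrm{Der}^{\mathrm{cycl}}$ is the Lie subalgebra of cyclic derivations and $\mathrm{Der}^{\mathrm{cycl}}_\pm=\mathrm{Der}^{\mathrm{cycl}}\cap\mathrm{Der}_\pm$. A cyclic involutive $A_\infty$-structure on $V$ is $m\in\mathrm{Der}_+^{\mathrm{cycl}}(\widehat T_{\ge1}\Sigma^{-1}V^* )$ of degree one with $m^2=0$. The form is non-degenerate if $V\to\Sigma^dV^*$, $v\mapsto\langle v,-\rangle$, is an isomorphism. **(Skew-)dihedral complexes.** Let $D_i=\langle r,s\mid r^i=s^2=1,\ srs^{-1}=r^{-1}\rangle$, of order $2i$, and $W=\Sigma^{-1}V^*$. The dihedral action on $W^{\otimes i}$ is $r(w_1\otimes\dots\otimes w_i)=(-1)^{|w_i|\sum_{j<i}|w_j|}w_i\otimes w_1\otimes\dots\otimes w_{i-1}$, $s(w)=w^*$; the skew-dihedral action has the same $r$ and $s(w)=-w^*$. $\mathrm{CD}^\bullet_+(V)=\Sigma\prod_{i\ge1}[(\Sigma^{-1}V^* )^{\otimes i}]_{D_i}$ (coinvariants for the dihedral action) and $\mathrm{CD}^\bullet_-(V)=\Sigma\prod_{i\ge1}[(\Sigma^{-1}V^* )^{\otimes i}]_{D_i}$ (coinvariants for the skew-dihedral action), each with the differential induced by $m$. *)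

(* Defs.v *)
From HB Require Import structures.
From mathcomp Require Import all_boot all_order all_algebra ring_quotient.
From mathcomp Require Import boolp classical_sets functions.

Set Implicit Arguments.
Unset Strict Implicit.
Unset Printing Implicit Defensive.

Import GRing.Theory.
Local Open Scope ring_scope.

Record submodule (k : fieldType) (M : lmodType k) := Submodule {
  smem :> M -> Prop;
  smem0 : smem 0;
  smemP : forall (a : k) x y, smem x -> smem y -> smem (a *: x + y)
}.

Section SubQuotient.
Variables (k : fieldType) (M : lmodType k) (S : submodule M).

Definition smemb : {pred M} := fun x => `[< smem S x >].

Fact smemb_closed : submod_closed smemb.
Proof.
split=> [|a x y /asboolP Sx /asboolP Sy]; apply/asboolP; first exact: smem0.
exact: smemP.
Qed.
HB.instance Definition _ := GRing.isSubmodClosed.Build k M smemb smemb_closed.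

Definition subm : Type := {x : M | smemb x}.
HB.instance Definition _ := SubChoice.on subm.
HB.instance Definition _ := [SubChoice_isSubLmodule of subm by <:].

Definition quotm : Type := Quotient.quot smemb.
HB.instance Definition _ := GRing.Zmodule.on quotm.

Definition qproj (x : M) : quotm := \pi_(Quotient.quot smemb)%qT x.
Definition qscale (a : k) (q : quotm) : quotm :=
  qproj (a *: repr (q : Quotient.quot smemb)).

Fact qprojP x y : qproj x = qproj y <-> smem S (x - y).
Proof.
rewrite /qproj; split.
  by move=> /eqP; rewrite -Quotient.idealrBE => /asboolP.
by move=> Sxy; apply/eqP; rewrite -Quotient.idealrBE; apply/asboolP.
Qed.

Fact qproj_surj (q : quotm) : exists x, qproj x = q.
Proof. by exists (repr (q : Quotient.quot smemb)); rewrite /qproj reprK. Qed.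

Fact qprojD : {morph qproj : x y / x + y}.
Proof. by move=> x y; rewrite /qproj !piE. Qed.

Fact qprojZ a x : qscale a (qproj x) = qproj (a *: x).
Proof.
apply/qprojP; rewrite -scalerBr -[X in smem S X]addr0.
apply: smemP; last exact: smem0.
by apply/qprojP; rewrite /qproj reprK.
Qed.

Fact qscaleA a b q : qscale a (qscale b q) = qscale (a * b) q.
Proof. by have [x <-] := qproj_surj q; rewrite !qprojZ scalerA. Qed.
Fact qscale1 : left_id 1 qscale.
Proof. by move=> q; have [x <-] := qproj_surj q; rewrite qprojZ scale1r. Qed.
Fact qscaleDr : right_distributive qscale +%R.
Proof.
move=> a p q; have [x <-] := qproj_surj p; have [y <-] := qproj_surj q.
by rewrite -qprojD !qprojZ scalerDr qprojD.
Qed.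
Fact qscaleDl q : {morph qscale^~ q : a b / a + b}.
Proof.
by move=> a b; have [x <-] := qproj_surj q; rewrite !qprojZ scalerDl qprojD.
Qed.
HB.instance Definition _ := GRing.Zmodule_isLmodule.Build k quotm
  qscaleA qscale1 qscaleDr qscaleDl.

End SubQuotient.

(* A graded space with, in each degree, a linear topology given by a base of
   neighbourhoods of 0. *)
Record tgraded (k : fieldType) := TGraded {
  tobj :> int -> lmodType k;
  tbase : forall i, set (set (tobj i))
}.

(* [dmap i j] is only meaningful for [j = i + 1]. *)
Record differential (k : fieldType) (C : int -> lmodType k) := Differential {
  dmap : forall i j, {linear C i -> C j};
  diff_shape : forall i j, j != i + 1 -> forall x, dmap i j x = 0;
  diff_sq : forall i j l x, dmap j l (dmap i j x) = 0
}.

Section Shift.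
Variables (k : fieldType) (n : int).

(* [Sigma^n k] sits in degree [-n]. *)
Definition susp (C : tgraded k) : tgraded k :=
  TGraded (fun i => @tbase k C (i + n)).

Variables (C : tgraded k) (dC : differential C).

Let sdiff i j : {linear C (i + n) -> C (j + n)} :=
  ((-1) ^ n : k) \*: dmap dC (i + n) (j + n).

Fact sdiff_shape i j : j != i + 1 -> forall x, sdiff i j x = 0.
Proof.
move=> ij x; rewrite /sdiff /= diff_shape ?scaler0 //.
by rewrite addrAC; apply: contraNneq ij => /addIr ->.
Qed.

Fact sdiff_sq i j l x : sdiff j l (sdiff i j x) = 0.
Proof. by rewrite /sdiff /= linearZ /= diff_sq !scaler0. Qed.

Definition susp_diff : differential (susp C) :=
  @Differential k (susp C) sdiff sdiff_shape sdiff_sq.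

End Shift.

(* Continuity at 0, hence everywhere for linear maps. *)
Definition tcontinuous (k : fieldType) (C D : tgraded k) i j (f : C i -> D j) :=
  forall U, tbase U -> exists2 U', tbase U' & (f @` U' `<=` U)%classic.

Definition complex_iso (k : fieldType) (C D : tgraded k)
    (dC : differential C) (dD : differential D) : Prop :=
  exists (f : forall i, {linear C i -> D i}) (g : forall i, D i -> C i),
    [/\ forall i, cancel (f i) (g i) /\ cancel (g i) (f i),
        forall i, tcontinuous (f i) /\ tcontinuous (g i) &
        forall i j x, f j (dmap dC i j x) = dmap dD i j (f i x)].

Record inv_graded (k : fieldType) := InvGraded {
  gobj :> int -> lmodType k;
  ginv : forall i, {linear gobj i -> gobj i};
  ginvK : forall i, involutive (ginv i)
}.

Record sym_form (k : fieldType) (V : inv_graded k) (d : int) := SymForm {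
  pairing :> forall i j, {bilinear V i -> V j -> k^o};
  (* [Sigma^d k] sits in degree [-d] *)
  pairing_deg : forall i j x y, i + j != - d -> pairing i j x y = 0;
  pairing_sym : forall i j x y,
    pairing i j x y = (-1) ^ (i * j) * pairing j i y x;
  pairing_inv : forall i j x y,
    pairing i j (ginv V i x) (ginv V j y) = pairing i j x y
}.

(* [V -> Sigma^d V^*] is bijective in degree [i]: the target is the dual of
   the component of [V] of degree [- d - i]. *)
Definition nondegenerate_form (k : fieldType) (V : inv_graded k) d (B : sym_form V d) :=
  forall i (phi : {linear V (- d - i) -> k^o}),
    exists! v : V i, B i (- d - i) v =1 phi.

Section TensorAlgebra.
Variables (k : fieldType) (V : inv_graded k).

Definition letter := {i : int & V i}.
Definition lett i (x : V i) : letter := Tagged (fun i => V i) x.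
Implicit Types (x y : letter) (u v w : seq letter) (m p : int).

(* The degree of a functional on [Sigma V] supported on the component of [x],
   i.e. of an element of [W = Sigma^-1 V^*]. *)
Definition ldeg x : int := 1 - tag x.
Definition ldegs w : seq int := map ldeg w.
Definition wdeg w : int := \sum_(e <- ldegs w) e.

Definition sg (e : int) : k := (-1) ^ e.
Definition pair_sum (s : seq int) : int :=
  \sum_(j < size s) \sum_(i < j) s`_i * s`_j.

Definition multilinear (f : seq letter -> k^o) : Prop :=
  forall u v i (a : k) (x y : V i),
    f (u ++ lett (a *: x + y) :: v) =
    a *: f (u ++ lett x :: v) + f (u ++ lett y :: v).

Definition findegs (f : seq letter -> k^o) : Prop :=
  exists D : seq int, forall w, f w != 0 -> wdeg w \in D.

Lemma ldegs_cat u v : ldegs (u ++ v) = ldegs u ++ ldegs v.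
Proof. exact: map_cat. Qed.

Lemma wdeg_cat u v : wdeg (u ++ v) = wdeg u + wdeg v.
Proof. by rewrite /wdeg ldegs_cat big_cat. Qed.

Lemma ldegs_slot u v i (x y : V i) :
  ldegs (u ++ lett x :: v) = ldegs (u ++ lett y :: v).
Proof. by rewrite !ldegs_cat. Qed.

(* The completed tensor algebra on [W = Sigma^-1 V^*].  A homogeneous element
   of the completed tensor power [W^(x n)] is a multilinear form on words of
   length [n] in homogeneous elements of [V], the tensor
   [w_1 (x) ... (x) w_n] being
   [x_1 ... x_n |-> w_1 x_1 * ... * w_n x_n] (no sign); an element of the
   product over [n] is a function on all words.  The product is taken in graded
   spaces, so elements are finite sums of homogeneous ones: [findegs]. *)
Definition tens_mem f : Prop := multilinear f /\ findegs f.

Fact tens_mem0 : tens_mem 0.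
Proof.
split=> [u v i a x y|]; first by rewrite scaler0 addr0.
by exists [::] => w; rewrite eqxx.
Qed.

Fact tens_memP (a : k) f g : tens_mem f -> tens_mem g -> tens_mem (a *: f + g).
Proof.
move=> [fl [D fD]] [gl [E gE]]; split=> [u v i b x y|].
  rewrite !fctE fl gl !scalerDr !scalerA [a * b]mulrC -!addrA.
  by congr (_ + _); rewrite addrCA.
exists (D ++ E) => w; rewrite mem_cat; apply: contraNT; rewrite negb_or.
move=> /andP[wD wE]; have /eqP fw : f w == 0 by apply: contraNT wD => /fD.
have /eqP gw : g w == 0 by apply: contraNT wE => /gE.
by rewrite !fctE fw gw scaler0 addr0.
Qed.

Definition tens_sub : submodule (seq letter -> k^o) :=
  Submodule tens_mem0 tens_memP.
Definition tens := subm tens_sub.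
HB.instance Definition _ := GRing.Lmodule.on tens.

Definition tval (f : tens) : seq letter -> k^o := val f.
Coercion tval : tens >-> Funclass.

Definition mktens f (Hf : tens_mem f) : tens := Sub f (asboolT Hf).

Fact tensP (f : tens) : tens_mem f.
Proof. exact: asboolW (valP f). Qed.

Definition homog m (f : tens) : Prop := forall w, f w != 0 -> wdeg w = m.
Definition arity n (f : tens) : Prop := forall w, f w != 0 -> size w = n.

Fact tmul_subproof (f g : tens) : tens_mem (fun w =>
  \sum_(p < (size w).+1) f (take p w) * g (drop p w)).
Proof.
have [fl [D fD]] := tensP f; have [gl [E gE]] := tensP g.
split=> [u v i a x y|].
  rewrite scaler_sumr !size_cat /= -big_split /=; apply: eq_bigr => p _.
  rewrite !take_cat !drop_cat; case: ltnP => [_|le_up].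
    by rewrite gl mulrDr scalerAr.
  case: (p - size u)%N => [|q] /=.
    by rewrite cats0 (gl [::] v) mulrDr scalerAr.
  by rewrite fl mulrDl scalerAl.
exists [seq d1 + d2 | d1 <- D, d2 <- E] => w.
case: (boolP [exists p : 'I_(size w).+1, f (take p w) * g (drop p w) != 0]).
  move=> /existsP[p]; rewrite mulf_eq0 negb_or => /andP[/fD fp /gE gp] _.
  by rewrite -[w](cat_take_drop p) wdeg_cat; apply: allpairs_f.
move=> /existsPn w0; rewrite big1 ?eqxx // => p _.
by apply/eqP; rewrite -[_ == _]negbK.
Qed.
Definition tmul (f g : tens) : tens := mktens (tmul_subproof f g).

Definition lstar x : letter := lett (ginv V (tag x) (tagged x)).

(* Since [w^*(x) = - w(x^* )] on [W], each letter contributes a sign. *)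
Fact tstar_subproof (f : tens) : tens_mem (fun w =>
  sg (pair_sum (ldegs w) + (size w)%:Z) *: f (rev (map lstar w))).
Proof.
have [fl [D fD]] := tensP f; split=> [u v i a x y|].
  rewrite (ldegs_slot u v (a *: x + y) y) (ldegs_slot u v x y) !size_cat /=.
  rewrite !map_cat /= !rev_cat !rev_cons -!cats1 -!catA /=.
  rewrite /lstar /= linearP fl scalerDr !scalerA.
  by rewrite [a * _]mulrC.
exists D => w; rewrite scaler_eq0 negb_or => /andP[_ /fD]; congr (_ \in D).
elim: w => //= x w IHw.
by rewrite rev_cons -cats1 wdeg_cat addrC IHw -(wdeg_cat [:: _] w) /wdeg.
Qed.
Definition tstar (f : tens) : tens := mktens (tstar_subproof f).

(* [r (w_1 ... w_n) = (-1)^(|w_n| (|w_1| + ... + |w_(n-1)|)) w_n w_1 ... w_(n-1)] *)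
Fact trot_subproof (f : tens) : tens_mem (fun w =>
  if w is x :: t then sg (ldeg x * wdeg t) *: f (rcons t x) else f [::]).
Proof.
have [fl [D fD]] := tensP f; split=> [[|z u] v i a x y|] /=.
- by rewrite -!cats1 fl scalerDr !scalerA [a * _]mulrC.
- rewrite -!cats1 -!catA /= fl scalerDr !scalerA [a * _]mulrC.
  by rewrite /wdeg (ldegs_slot u v (a *: x + y) y) (ldegs_slot u v x y).
exists D => -[|x t] /=; first exact: fD.
rewrite scaler_eq0 negb_or => /andP[_ /fD]; congr (_ \in D).
by rewrite -cats1 wdeg_cat addrC -wdeg_cat.
Qed.
Definition trot (f : tens) : tens := mktens (trot_subproof f).

Fact tens_eq (f g : tens) : f =1 g -> f = g.
Proof. by move=> fg; apply/val_inj/funext. Qed.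

Fact tensE (a : k) (f g : tens) w : (a *: f + g : tens) w = a * f w + g w.
Proof. by []. Qed.
Fact tens0E w : (0 : tens) w = 0.
Proof. by []. Qed.
Fact tensZE (a : k) (f : tens) w : (a *: f : tens) w = a * f w.
Proof. by []. Qed.

Fact tmulE (f g : tens) w :
  tmul f g w = \sum_(p < (size w).+1) f (take p w) * g (drop p w).
Proof. by []. Qed.

Fact tmul_linearl (a : k) (f g h : tens) :
  tmul (a *: f + g) h = a *: tmul f h + tmul g h.
Proof.
apply: tens_eq => w; rewrite tensE !tmulE mulr_sumr -big_split.
by apply: eq_bigr => p _; rewrite tensE mulrDl mulrA.
Qed.
Fact tmul_linearr (a : k) (f g h : tens) :
  tmul h (a *: f + g) = a *: tmul h f + tmul h g.
Proof.
apply: tens_eq => w; rewrite tensE !tmulE mulr_sumr -big_split.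
by apply: eq_bigr => p _; rewrite tensE mulrDr mulrCA.
Qed.

Fact tstarE (f : tens) w : tstar f w =
  sg (pair_sum (ldegs w) + (size w)%:Z) * f (rev (map lstar w)).
Proof. by []. Qed.
Fact trot_nil (f : tens) : trot f [::] = f [::].
Proof. by []. Qed.
Fact trot_cons (f : tens) x t :
  trot f (x :: t) = sg (ldeg x * wdeg t) * f (rcons t x).
Proof. by []. Qed.

Fact tstar_linear (a : k) (f g : tens) :
  tstar (a *: f + g) = a *: tstar f + tstar g.
Proof. by apply: tens_eq => w; rewrite tensE !tstarE tensE mulrDr mulrCA. Qed.

Fact trot_linear (a : k) (f g : tens) :
  trot (a *: f + g) = a *: trot f + trot g.
Proof.
apply: tens_eq => -[|x t]; first by rewrite tensE !trot_nil tensE.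
by rewrite tensE !trot_cons tensE mulrDr mulrCA.
Qed.

End TensorAlgebra.

Section Derivations.
Variables (k : fieldType) (V : inv_graded k).
Local Notation tens := (tens V).
Local Notation letter := (letter V).
Local Notation sg := (sg k).
Implicit Types (xi eta : tens -> tens) (f g : tens) (w : seq letter).
Implicit Types (m p : int).

(* The inverse limit topology on the degree [m] part of the completed tensor
   algebra is the topology of pointwise convergence on words. *)
Definition continuous_op xi : Prop :=
  forall m w, exists S : seq (seq letter),
    forall f, homog m f -> (forall u, u \in S -> f u = 0) -> xi f w = 0.

Record is_derivation p xi : Prop := IsDerivation {
  der_linear : linear xi;
  der_deg : forall m f, homog m f -> homog (m + p) (xi f);
  der_leibniz : forall m f g, homog m f ->
    xi (tmul f g) = tmul (xi f) g + sg (p * m) *: tmul f (xi g);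
  der_cont : continuous_op xi
}.

Definition bracket p q xi eta : tens -> tens :=
  fun f => xi (eta f) - sg (p * q) *: eta (xi f).

Definition dstar xi : tens -> tens := fun f => tstar (xi (tstar f)).

Definition tags w : seq int := map tag w.
Definition tagsum w : int := \sum_(i <- tags w) i.

(* [hat xi_n] maps the word [x_1 ... x_n] to an element of [V] of this degree,
   on which functionals have degree [wdeg w - p] as elements of [W]. *)
Definition hat_deg p w : int := tagsum w + p + 1 - (size w)%:Z.

(* The Koszul sign relating [xi_n] to [hat xi_n]: the transpose of [xi_n] gives
   [p * |phi|], the unsigned evaluation of tensors on words is turned into the
   Koszul one by [sum_(i < j) |s x_i| |s x_j|], and the desuspension
   [V^(x n) -> (Sigma V)^(x n)] gives [sum_i (n - i) |x_i|]. *)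
Definition hat_sign p w : k :=
  sg (p * (wdeg w - p) + pair_sum (ldegs w)
      + \sum_(i < size w) (size w - i.+1)%:Z * (tags w)`_i).

Definition is_hat p xi (h : forall w, V (hat_deg p w)) : Prop :=
  forall phi : tens, arity 1 phi ->
    forall w, xi phi w = hat_sign p w * phi [:: lett (h w)].

Section Cyclic.
Variables (d : int) (B : sym_form V d).

Definition is_cyclic p xi : Prop :=
  exists h : forall w, V (hat_deg p w), is_hat xi h /\
    forall (u : seq letter) (z y : letter), let w := rcons u z in
      B _ _ (h w) (tagged y) =
      sg (tag y * tagsum w + (size w)%:Z) * B _ _ (h (y :: u)) (tagged z).

(* [b = false] and [b = true] select the eigenvalues [+1] and [-1]. *)
Definition cycl_der_mem (b : bool) p xi : Prop :=
  [/\ is_derivation p xi, is_cyclic p xi & dstar xi = (-1) ^+ b *: xi].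

Fact op0E f : (0 : tens -> tens) f = 0.
Proof. by []. Qed.
Fact opE (a : k) xi eta f : (a *: xi + eta) f = a *: xi f + eta f.
Proof. by []. Qed.

Fact cycl_der_mem0 b p : cycl_der_mem b p 0.
Proof.
split.
- split=> [a f g|m f _ w|m f g _|m w].
  + by rewrite !op0E scaler0 addr0.
  + by rewrite op0E tens0E eqxx.
  + apply: tens_eq => w; rewrite !op0E addrC tensE /=.
    by rewrite /tval /= !big1 ?mulr0 ?addr0 // => i _; rewrite ?mulr0 ?mul0r.
  + by exists [::].
- exists (fun=> 0); split=> [phi _ w|u z y w]; last by rewrite !linear0l mulr0.
  have [phil _] := tensP phi.
  have := phil [::] [::] _ 1 0 (0 : V (hat_deg p w)).
  rewrite /= !scale1r addr0 => phi0.
  suff -> : phi [:: lett (0 : V (hat_deg p w))] = 0 by rewrite mulr0.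
  by apply: (addrI (phi [:: lett (0 : V (hat_deg p w))])); rewrite -phi0 addr0.
apply/funext => f; rewrite /dstar scaler0 !op0E.
by apply: tens_eq => w; rewrite /tval /= scaler0.
Qed.

Fact cycl_der_memP b p (a : k) xi eta :
  cycl_der_mem b p xi -> cycl_der_mem b p eta -> cycl_der_mem b p (a *: xi + eta).
Proof.
move=> [[xl xd xL xc] [hx [hxE hxC]] xs] [[el ed eL ec] [he [heE heC]] es].
split.
- split=> [c f g|m f hf w|m f g hf|m w]; rewrite ?opE.
  + rewrite xl el !scalerDr !scalerA [a * c]mulrC -!addrA.
    by congr (_ + _); rewrite addrCA.
  + rewrite tensE; apply: contra_neqP => wm.
    have /eqP -> : xi f w == 0 by apply: contra_notT wm => /(xd _ _ hf).
    have /eqP -> : eta f w == 0 by apply: contra_notT wm => /(ed _ _ hf).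
    by rewrite mulr0 addr0.
  + rewrite (xL _ _ _ hf) (eL _ _ _ hf) tmul_linearl tmul_linearr.
    rewrite !scalerDr !scalerA [a * _]mulrC -!addrA; congr (_ + _).
    by rewrite addrCA.
  + have [S HS] := xc m w; have [S' HS'] := ec m w.
    exists (S ++ S') => f hf fS; rewrite opE tensE HS ?HS' ?mulr0 ?addr0 // => u uS;
      by apply: fS; rewrite mem_cat uS ?orbT.
- exists (fun w => a *: hx w + he w); split=> [phi phi1 w|u z y w].
    rewrite opE tensE (hxE _ phi1) (heE _ phi1).
    have [phil _] := tensP phi.
    rewrite [X in _ = _ * X](phil [::] [::] _ a (hx w) (he w)) /=.
    by rewrite mulrDr [a * _]mulrCA.
  by rewrite !linearPl /= hxC heC mulrDr; congr (_ + _); rewrite scalerAr.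
apply/funext => f; have := congr1 (@^~ f) xs; have := congr1 (@^~ f) es.
rewrite /dstar opE tstar_linear => -> ->.
by rewrite -[RHS]/(_ *: (_ + _)) scalerDr !scalerA [a * _]mulrC.
Qed.

Definition cycl_der (b : bool) (p : int) : lmodType k :=
  subm (Submodule (@cycl_der_mem0 b p) (@cycl_der_memP b p)).
Definition derv b p (xi : cycl_der b p) : tens -> tens := val xi.

(* [Der^cycl_+] for [b = false] and [Der^cycl_-] for [b = true], with the
   topology of pointwise convergence. *)
Definition Der_cycl (b : bool) : tgraded k :=
  @TGraded k (cycl_der b) (fun p =>
    [set [set xi : cycl_der b p | forall e, e \in S -> derv xi e.1 e.2 = 0]
      | S in [set: seq (tens * seq letter)]]%classic).

Record cyc_inv_Ainf := CycInvAinf {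
  ainf : cycl_der false 1;
  ainf_reduced : forall phi : tens, arity 1 phi -> derv ainf phi [::] = 0;
  ainf_sq : forall f, derv ainf (derv ainf f) = 0
}.

End Cyclic.
End Derivations.

Section DihedralComplex.
Variables (k : fieldType) (V : inv_graded k).
Local Notation tens := (tens V).
Local Notation letter := (letter V).
Implicit Types (b : bool) (m : int).

Definition tpos_mem m (f : tens) : Prop := homog m f /\ f [::] = 0.

Fact tpos_mem0 m : tpos_mem m 0.
Proof. by split=> // w; rewrite tens0E eqxx. Qed.

Fact tpos_memP m (a : k) f g :
  tpos_mem m f -> tpos_mem m g -> tpos_mem m (a *: f + g).
Proof.
move=> [hf f0] [hg g0]; split; last by rewrite tensE f0 g0 mulr0 addr0.
move=> w; rewrite tensE; apply: contra_neqP => wm.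
have /eqP -> : f w == 0 by apply: contra_notT wm => /hf.
have /eqP -> : g w == 0 by apply: contra_notT wm => /hg.
by rewrite mulr0 addr0.
Qed.

(* The degree [m] part of the reduced completed tensor algebra. *)
Definition tpos m : lmodType k := subm (Submodule (tpos_mem0 m) (@tpos_memP m)).
Definition tposv m (f : tpos m) : tens := val f.

Fact tposvP m (c : k) (f g : tpos m) :
  tposv (c *: f + g) = c *: tposv f + tposv g.
Proof. exact: (linearP (\val : tpos m -> tens)). Qed.

(* The element [r^a s^e] of the dihedral group, acting by the dihedral action
   for [b = false] and by the skew-dihedral one for [b = true]. *)
Definition dih_act b (a : nat) (e : bool) (f : tens) : tens :=
  iter a (@trot k V) (if e then (-1) ^+ b *: tstar f else f).

Fact dih_act_linear b a e : linear (dih_act b a e).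
Proof.
move=> c f g; rewrite /dih_act; elim: a => [|a /= ->]; last exact: trot_linear.
case: e => //=.
by rewrite tstar_linear scalerDr !scalerA [c * _]mulrC.
Qed.

(* In each arity [n], [f] lies in the span of the [g x - x] for [g] in the
   dihedral group of order [2 n]. *)
Definition dih_rel b m (f : tpos m) : Prop :=
  forall n, exists x : 'I_n -> bool -> tens,
    (forall a e, homog m (x a e) /\ arity n (x a e)) /\
    forall w, size w = n ->
      tposv f w = \sum_(a < n) \sum_e (dih_act b a e (x a e) - x a e : tens) w.

Fact dih_rel0 b m : @dih_rel b m 0.
Proof.
move=> n; exists (fun _ _ => 0); split=> [a e|w _].
  by split=> w; rewrite tens0E eqxx.
rewrite big1 // => a _; rewrite big1 // => e _.
have := dih_act_linear b a e (-1) 0 0; rewrite scaler0 addr0 scaleN1r addNr => ->.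
by rewrite subrr.
Qed.

Fact dih_relP b m (c : k) (f g : tpos m) :
  dih_rel b f -> dih_rel b g -> dih_rel b (c *: f + g).
Proof.
move=> hf hg n; have [x [xm xE]] := hf n; have [y [ym yE]] := hg n.
exists (fun a e => c *: x a e + y a e); split=> [a e|w wn].
  have [[xh xn] [yh yn]] := (xm a e, ym a e).
  split=> w; rewrite tensE; apply: contra_neqP => wm.
    have /eqP -> : x a e w == 0 by apply: contra_notT wm => /xh.
    have /eqP -> : y a e w == 0 by apply: contra_notT wm => /yh.
    by rewrite mulr0 addr0.
  have /eqP -> : x a e w == 0 by apply: contra_notT wm => /xn.
  have /eqP -> : y a e w == 0 by apply: contra_notT wm => /yn.
  by rewrite mulr0 addr0.
rewrite tposvP tensE xE // yE // mulr_sumr -big_split /=.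
apply: eq_bigr => a _; rewrite mulr_sumr -big_split /=; apply: eq_bigr => e _.
rewrite dih_act_linear -tensE; congr (tval _ w).
by rewrite scalerBr opprD addrACA.
Qed.

Definition dih_coinv b m : lmodType k :=
  quotm (Submodule (@dih_rel0 b m) (@dih_relP b m)).
Definition dih_class b m (f : tpos m) : dih_coinv b m := qproj _ f.

(* The product over [n >= 1] of the coinvariants, with the quotient of the
   inverse limit topology; [CD] is its suspension. *)
Definition Dih b : tgraded k :=
  @TGraded k (dih_coinv b) (fun m =>
    [set @dih_class b m @` [set f : tpos m | forall w, w \in S -> tposv f w = 0]
      | S in [set: seq (seq letter)]]%classic).
Definition CD b : tgraded k := susp 1 (Dih b).

End DihedralComplex.

Section Differentials.
Variables (k : fieldType) (V : inv_graded k) (d : int) (B : sym_form V d).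
Variable (m : cyc_inv_Ainf B).

Definition is_induced_diff b (dC : differential (Dih V b)) : Prop :=
  forall p (f : tpos V p), exists g : tpos V (p + 1),
    tposv g = derv (ainf m) (tposv f) /\
    dmap dC p (p + 1) (dih_class b f) = dih_class b g.

Definition CD_diff b (dC : differential (Dih V b)) : differential (CD V b) :=
  susp_diff 1 dC.

Definition is_ad_diff b (dD : differential (Der_cycl B b)) : Prop :=
  forall p (xi : cycl_der B b p),
    derv (dmap dD p (p + 1) xi) = bracket 1 p (derv (ainf m)) (derv xi).

End Differentials.

(* Main.v *)
Require Import Defs.
From HB Require Import structures.
From mathcomp Require Import all_boot all_order all_algebra zify ring.
From mathcomp Require Import boolp classical_sets functions.

Set Implicit Arguments.
Unset Strict Implicit.
Unset Printing Implicit Defensive.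

Import GRing.Theory.
Local Open Scope ring_scope.

(** A derivation [xi] of the completed tensor algebra is determined by the
  tensors [xi phi_y], where [phi_y = <-, y>] runs through the functionals
  defined by the form; all functionals are of this kind, by non-degeneracy. So
  [xi] is determined by the tensor [H (w y) = xi phi_y (w)], of arity one more,
  which is its Hamiltonian [ham] after insertion of a sign depending on the
  degrees of [xi] and [y]. If [xi] has degree [p] then [H] has degree
  [p + d + 2]. The sign is such that the cyclicity of [xi] is the invariance of
  [H] under rotation ([cyclic_word], [ham_surj]), and that the involution on
  cyclic derivations is the action of the reflection on Hamiltonians
  ([ham_dstar]). Hence the cyclic derivations in an eigenspace of the
  involution are the invariants of the (skew-)dihedral action. In
  characteristic zero the norm identifies the coinvariants with them: in arity
  [n] the norm of the dihedral group of order [2 n] kills exactly the relations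
  of the coinvariants ([dih_rel_dnorm]), and it is onto the invariants, as
  these can be divided by [2 n] ([dnorm_average]).

  It remains to compare the differentials, and both are the same sum over the
  cyclic words. The Hamiltonian of [[m, xi]] is obtained from [H] by
  substituting [m] at all the places of the cyclic word [w y] ([ham_bracket]):
  [m (xi phi_y)] accounts for the places which avoid [y], and [xi (m phi_y)],
  thanks to the cyclicity of [m], for those which contain it. On the other
  hand, the norm of [m f] is the same sum for the norm of [f], because the
  action of [m] at an inner place of a word is its action at the initial place
  of a rotated word ([cnorm_ext]). The latter also shows that [m] preserves the
  relations of the coinvariants.

  All this relies on an explicit formula for derivations. A family of functionals
  prescribed in arity one extends to a derivation by a sum over the
  factorizations [w = u v t] ([ext_derivation]). Conversely, derivations which
  agree on the [phi_y] are equal ([der_unique]): tensors are not polynomials in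
  the [phi_y], but on finitely many words they coincide with polynomials,
  because the form provides endomorphisms of finite rank which fix any given
  vectors ([finite_rank_letters]), and derivations are continuous. *)

(** * Signs and parities *)

Definition oddz (n : int) : bool := odd `|n|%N.

Lemma oddzD a b : oddz (a + b) = oddz a (+) oddz b.
Proof. rewrite /oddz; lia. Qed.

Lemma oddzN a : oddz (- a) = oddz a.
Proof. by rewrite /oddz abszN. Qed.

Lemma oddzM a b : oddz (a * b) = oddz a && oddz b.
Proof. by rewrite /oddz abszM oddM. Qed.

Lemma oddz1 : oddz 1 = true. Proof. by []. Qed.
Lemma oddz0 : oddz 0 = false. Proof. by []. Qed.
Lemma oddzS n : oddz n.+1%:Z = ~~ oddz n.
Proof. by []. Qed.

Definition oddzE := (oddzD, oddzN, oddzM, oddzS, oddz1, oddz0).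

Section Signs.
Variable k : fieldType.
Local Notation sg := (sg k).

Lemma sg_oddz e : sg e = (-1) ^+ oddz e.
Proof.
rewrite /sg /oddz; rewrite signr_odd; case: e => n; first by [].
by rewrite NegzE -invr_expz -exprnP abszN -exprVn invrN1.
Qed.

Lemma sgD a b : sg (a + b) = sg a * sg b.
Proof. by rewrite !sg_oddz oddzD signr_addb. Qed.

Lemma sg_eq a b : oddz a = oddz b -> sg a = sg b.
Proof. by rewrite !sg_oddz => ->. Qed.

Lemma sg0 : sg 0 = 1. Proof. by []. Qed.

Lemma sg_sq a : sg a * sg a = 1.
Proof. by rewrite !sg_oddz -signr_addb addbb. Qed.

Lemma sg_neq0 a : sg a != 0.
Proof. by rewrite sg_oddz signr_eq0. Qed.

End Signs.

(** An equality of Koszul signs is a boolean identity between the parities of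
  the degrees involved; it is decided by exhaustion. *)
Ltac case_parity := repeat match goal with |- context [oddz ?n] => case: (oddz n) => //= end.
Ltac parity := rewrite -?sgD; apply: sg_eq; rewrite ?oddzE; case_parity.

(** * Sums over the factorizations of a word *)

Section Deconcatenation.
Variables (k : fieldType) (T : Type).
Implicit Types (G : seq T -> seq T -> k) (u v w t : seq T).

(** Dual to the coproduct of the tensor coalgebra on letters. Products and
  derivations of tensors are iterated sums of this form, and their identities
  come from the coassociativity [deconcA] and from the behaviour under
  concatenation and reversal. *)
Definition deconc G w : k := \sum_(i < (size w).+1) G (take i w) (drop i w).

Lemma deconc_nil G : deconc G [::] = G [::] [::].
Proof. by rewrite /deconc big_ord_recl big_ord0 addr0. Qed.

Lemma deconc_cons G x w :
  deconc G (x :: w) = G [::] (x :: w) + deconc (fun u v => G (x :: u) v) w.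
Proof. by rewrite /deconc big_ord_recl. Qed.

Lemma eq_deconc G G' w :
  (forall u v, u ++ v = w -> G u v = G' u v) -> deconc G w = deconc G' w.
Proof. by move=> GG; apply: eq_bigr => i _; rewrite GG ?cat_take_drop. Qed.

Lemma deconc0 w : deconc (fun _ _ => 0) w = 0.
Proof. exact: big1. Qed.

Lemma deconcD G G' w :
  deconc (fun u v => G u v + G' u v) w = deconc G w + deconc G' w.
Proof. exact: big_split. Qed.

Lemma deconcZ c G w : deconc (fun u v => c * G u v) w = c * deconc G w.
Proof. by rewrite /deconc mulr_sumr. Qed.

Lemma deconcMr c G w : deconc (fun u v => G u v * c) w = deconc G w * c.
Proof. by rewrite /deconc mulr_suml. Qed.

Lemma deconc_rcons G w x : deconc G (rcons w x) =
  deconc (fun u v => G u (rcons v x)) w + G (rcons w x) [::].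
Proof.
elim: w G => [|y w IH] G; first by rewrite /= deconc_cons !deconc_nil.
by rewrite rcons_cons !deconc_cons IH addrA.
Qed.

Lemma deconcA (G : seq T -> seq T -> seq T -> k) w :
  deconc (fun u r => deconc (G u) r) w =
  deconc (fun l t => deconc (fun u v => G u v t) l) w.
Proof.
elim: w G => [|x w IH] G; first by rewrite !deconc_nil.
rewrite !deconc_cons deconc_nil IH -addrA -deconcD; congr (_ + _).
by apply: eq_deconc => u v _; rewrite deconc_cons.
Qed.

Lemma deconc_rev G w :
  deconc G (rev w) = deconc (fun u v => G (rev v) (rev u)) w.
Proof.
elim: w G => [|x w IH] G; first by rewrite !deconc_nil.
rewrite rev_cons deconc_rcons IH deconc_cons addrC.
by rewrite rev_cons; congr (_ + _); apply: eq_deconc => u v _; rewrite rev_cons.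
Qed.

Lemma deconc_map h G w :
  deconc G (map h w) = deconc (fun u v => G (map h u) (map h v)) w.
Proof.
elim: w G => [|x w IH] G; first by rewrite !deconc_nil.
by rewrite /= !deconc_cons IH.
Qed.

Lemma deconc_neq0 G w :
  deconc G w != 0 -> exists u v, w = u ++ v /\ G u v != 0.
Proof.
move=> nz; case: (boolP [exists i : 'I_(size w).+1, G (take i w) (drop i w) != 0]).
  by move=> /existsP[i Gi]; exists (take i w), (drop i w); rewrite cat_take_drop.
move=> /existsPn G0; move: nz; rewrite /deconc big1 ?eqxx // => i _.
by apply/eqP; rewrite -[_ == _]negbK.
Qed.

Lemma deconc_first G w :
  (forall u v, u ++ v = w -> u <> [::] -> G u v = 0) -> deconc G w = G [::] w.
Proof.
move=> G0; rewrite /deconc big_ord_recl take0 drop0 big1 ?addr0 // => i _.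
apply: G0; first by rewrite cat_take_drop.
case: w i => [|x w] //= i; by case: i.
Qed.

Lemma deconc_last G w :
  (forall u v, u ++ v = w -> v <> [::] -> G u v = 0) -> deconc G w = G w [::].
Proof.
move=> G0; rewrite -[in LHS](revK w) deconc_rev deconc_first ?revK // => u v uv un.
apply: G0; first by rewrite -rev_cat uv revK.
by move=> ru; apply: un; rewrite -[u]revK ru.
Qed.

End Deconcatenation.

Section PairSum.
Implicit Types s t : seq int.
Definition tot s : int := \sum_(e <- s) e.

Lemma tot_cat s t : tot (s ++ t) = tot s + tot t.
Proof. exact: big_cat. Qed.
Lemma tot_cons x s : tot (x :: s) = x + tot s.
Proof. exact: big_cons. Qed.
Lemma tot_nil : tot [::] = 0.
Proof. exact: big_nil. Qed.
Lemma tot_rev s : tot (rev s) = tot s.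
Proof.
elim: s => // x s IH; rewrite rev_cons -cats1 tot_cat !tot_cons IH tot_nil.
by rewrite addr0 addrC.
Qed.

Lemma pair_sum_nil : pair_sum [::] = 0.
Proof. by rewrite /pair_sum big_ord0. Qed.

Lemma pair_sum_rcons s x : pair_sum (rcons s x) = pair_sum s + tot s * x.
Proof.
rewrite /pair_sum size_rcons big_ord_recr /=; congr (_ + _).
  apply: eq_bigr => j _; apply: eq_bigr => i _.
  by rewrite !nth_rcons ltn_ord (ltn_trans (ltn_ord i)).
rewrite /tot (big_nth 0) big_mkord mulr_suml; apply: eq_bigr => i _.
by rewrite !nth_rcons ltn_ord ltnn eqxx.
Qed.

Lemma pair_sum_cat s t : pair_sum (s ++ t) = pair_sum s + pair_sum t + tot s * tot t.
Proof.
elim/last_ind: t => [|t x IH].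
  by rewrite cats0 pair_sum_nil tot_nil mulr0 !addr0.
rewrite -rcons_cat !pair_sum_rcons IH tot_cat -cats1 tot_cat tot_cons tot_nil; ring.
Qed.

Lemma pair_sum_rev s : pair_sum (rev s) = pair_sum s.
Proof.
elim: s => // x s IH; rewrite rev_cons pair_sum_rcons IH tot_rev.
rewrite -[x :: s]/([:: x] ++ s) pair_sum_cat -[[:: x]]/(rcons [::] x) pair_sum_rcons.
rewrite pair_sum_nil tot_nil tot_cons tot_nil; ring.
Qed.
End PairSum.

(** * Letters, words and tensors *)

Section Tensors.
Variables (k : fieldType) (V : inv_graded k).
Local Notation tens := (tens V).
Local Notation letter := (letter V).
Local Notation word := (seq letter).
Local Notation sg := (sg k).
Implicit Types (f g : tens) (u v w t : word) (x y z : letter).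

Lemma scale_mulE (a : k) (b : k^o) : a *: b = a * b.
Proof. by []. Qed.

Lemma wdeg_nil : wdeg ([::] : word) = 0.
Proof. exact: tot_nil. Qed.
Lemma wdeg_cons x w : wdeg (x :: w) = ldeg x + wdeg w.
Proof. exact: tot_cons. Qed.
Lemma wdeg_rcons w x : wdeg (rcons w x) = wdeg w + ldeg x.
Proof. by rewrite -cats1 wdeg_cat wdeg_cons wdeg_nil addr0. Qed.
Lemma wdeg1 x : wdeg [:: x] = ldeg x.
Proof. by rewrite wdeg_cons wdeg_nil addr0. Qed.
Lemma wdeg_slot u v i (x y : V i) :
  wdeg (u ++ lett x :: v) = wdeg (u ++ lett y :: v).
Proof. by rewrite /wdeg (ldegs_slot u v x y). Qed.
Lemma tot_ldegs w : tot (ldegs w) = wdeg w.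
Proof. by []. Qed.
Definition wdegE := (wdeg_nil, wdeg_cons, wdeg_rcons, wdeg_cat).

Lemma letterE x : x = lett (tagged x).
Proof. by case: x. Qed.

Definition letter_linear (g : letter -> k) := forall i (a : k) (x y : V i),
  g (lett (a *: x + y)) = a * g (lett x) + g (lett y).

Lemma letter_linear0 (g : letter -> k) i : letter_linear g -> g (lett (0 : V i)) = 0.
Proof.
move=> gl; have := gl i 1 0 0; rewrite scale1r addr0 mul1r => /eqP.
by rewrite -subr_eq0 opprD addrA subrr sub0r oppr_eq0 => /eqP.
Qed.

Lemma letter_linearZ (g : letter -> k) i (a : k) (x : V i) :
  letter_linear g -> g (lett (a *: x)) = a * g (lett x).
Proof. by move=> gl; rewrite -[a *: x]addr0 gl letter_linear0 // addr0. Qed.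

Lemma letter_linear_sum (g : letter -> k) i (I : Type) (r : seq I) (c : I -> k) (e : I -> V i) :
  letter_linear g ->
  g (lett (\sum_(j <- r) c j *: e j)) = \sum_(j <- r) c j * g (lett (e j)).
Proof.
move=> gl; elim: r => [|j r IH]; first by rewrite !big_nil letter_linear0.
by rewrite !big_cons gl IH.
Qed.

Lemma multilinear_slot (f : word -> k^o) u v :
  multilinear f -> letter_linear (fun z => f (u ++ z :: v)).
Proof. by move=> fl i a x y; rewrite fl. Qed.

Lemma tens_slot f u v : letter_linear (fun z => f (u ++ z :: v)).
Proof. by apply: multilinear_slot; case: (tensP f). Qed.

Lemma multilinear_degs (c : seq int -> k) (f : word -> k^o) :
  multilinear f -> multilinear (fun w => c (ldegs w) * f w : k^o).
Proof.
move=> fl u v i a x y.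
rewrite (ldegs_slot u v (a *: x + y) y) (ldegs_slot u v x y) fl.
by rewrite mulrDr scalerAr.
Qed.

Lemma multilinear_deconc (G : word -> word -> k^o) :
  (forall v, multilinear (G^~ v)) -> (forall u, multilinear (G u)) ->
  multilinear (fun w => deconc G w : k^o).
Proof.
move=> Gl Gr u v i a x y.
rewrite /deconc !size_cat /= scaler_sumr -big_split /=; apply: eq_bigr => p _.
rewrite !take_cat !drop_cat; case: ltnP => [_|le_up]; first by rewrite Gr.
case: (p - size u)%N => [|q] /=; first by rewrite cats0 (Gr u [::] v).
by rewrite Gl.
Qed.

Lemma findegs_homog m (f : word -> k^o) :
  (forall w, f w != 0 -> wdeg w = m) -> findegs f.
Proof. by move=> fm; exists [:: m] => w /fm ->; rewrite inE. Qed.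

Lemma mktensE (f : word -> k^o) (Hf : tens_mem f) w : mktens Hf w = f w.
Proof. by []. Qed.

Lemma tens_sumE (I : Type) (r : seq I) (P : pred I) (f : I -> tens) w :
  (\sum_(i <- r | P i) f i : tens) w = \sum_(i <- r | P i) f i w.
Proof.
elim/big_rec2: _ => [|i y h Pi <-]; first exact: tens0E.
by rewrite -[f i in LHS]scale1r tensE mul1r.
Qed.

Lemma tensD f g w : (f + g : tens) w = f w + g w. Proof. by []. Qed.
Lemma tensN f w : (- f : tens) w = - f w. Proof. by []. Qed.

(** Restrictions to words with prescribed letter degrees are multilinear again
  since these degrees do not depend on the vectors. Homogeneous components and
  arity components are both of this form. *)
Fact restrict_subproof (P : pred (seq int)) f :
  tens_mem (fun w => (P (ldegs w))%:R * f w : k^o).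
Proof.
have [fl [D fD]] := tensP f; split; first exact: (multilinear_degs (fun s => (P s)%:R)).
by exists D => w; rewrite mulf_eq0 negb_or => /andP[_ /fD].
Qed.
Definition restrict P f : tens := mktens (restrict_subproof P f).
Lemma restrictE P f w : restrict P f w = (P (ldegs w))%:R * f w.
Proof. by []. Qed.

Definition degree_part m f := restrict (fun s => tot s == m) f.
Definition arity_part n f := restrict (fun s => size s == n) f.

Lemma degree_partE m f w : degree_part m f w = (wdeg w == m)%:R * f w.
Proof. by []. Qed.
Lemma arity_partE n f w : arity_part n f w = (size w == n)%:R * f w.
Proof. by rewrite restrictE size_map. Qed.

Lemma degree_part_homog m f : homog m (degree_part m f).
Proof. by move=> w; rewrite degree_partE; have [//|] := eqVneq (wdeg w) m; rewrite mul0r eqxx. Qed.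
Lemma arity_part_arity n f : arity n (arity_part n f).
Proof. by move=> w; rewrite arity_partE; have [//|] := eqVneq (size w) n; rewrite mul0r eqxx. Qed.
Lemma arity_part_homog n m f : homog m f -> homog m (arity_part n f).
Proof. by move=> fm w; rewrite arity_partE mulf_eq0 negb_or => /andP[_ /fm]. Qed.
Lemma homog_sum_degrees f :
  exists D : seq int, f = \sum_(m <- D) degree_part m f.
Proof.
have [_ [D fD]] := tensP f; exists (undup D); apply: tens_eq => w.
rewrite tens_sumE; under eq_bigr do rewrite degree_partE.
case: (eqVneq (f w) 0) => [->|/fD]; first by rewrite big1 // => i _; rewrite mulr0.
rewrite -mem_undup => wD; rewrite (bigD1_seq (wdeg w)) ?undup_uniq //= eqxx mul1r.
by rewrite big1 ?addr0 // => i; rewrite eq_sym => /negbTE ->; rewrite mul0r.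
Qed.

Lemma homog_eq0 m f w : homog m f -> wdeg w != m -> f w = 0.
Proof. by move=> fm; apply: contraNeq => /fm ->. Qed.
Lemma arity_eq0 n f w : arity n f -> size w != n -> f w = 0.
Proof. by move=> fn; apply: contraNeq => /fn ->. Qed.

Lemma homog_lin m (a : k) f g : homog m f -> homog m g -> homog m (a *: f + g).
Proof.
move=> hf hg w; have [//|wm] := eqVneq (wdeg w) m.
by rewrite tensE (homog_eq0 hf wm) (homog_eq0 hg wm) mulr0 addr0 eqxx.
Qed.
Lemma homog0 m : homog m (0 : tens).
Proof. by move=> w; rewrite tens0E eqxx. Qed.
Lemma homogZ m (a : k) f : homog m f -> homog m (a *: f).
Proof. by move=> hf; rewrite -[_ *: _]addr0; apply: homog_lin (homog0 m). Qed.
Lemma homog_sum (I : Type) (r : seq I) (P : pred I) (f : I -> tens) m :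
  (forall i, P i -> homog m (f i)) -> homog m (\sum_(i <- r | P i) f i).
Proof.
move=> fm; elim/big_rec: _ => [|i h Pi hh]; first exact: homog0.
by rewrite -[f i]scale1r; apply: homog_lin (fm i Pi) hh.
Qed.

Lemma tmul_deconc f g w : tmul f g w = deconc (fun u v => f u * g v) w.
Proof. by []. Qed.

Lemma tmul_homog m n f g : homog m f -> homog n g -> homog (m + n) (tmul f g).
Proof.
move=> fm gn w; rewrite tmul_deconc => /deconc_neq0[u [v [-> ]]].
by rewrite mulf_eq0 negb_or => /andP[/fm um /gn vn]; rewrite wdeg_cat um vn.
Qed.

Fact functional_subproof (g : letter -> k) :
  letter_linear g -> (exists D : seq int, forall z, g z != 0 -> ldeg z \in D) ->
  tens_mem (fun w => if w is [:: z] then g z else 0 : k^o).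
Proof.
move=> gl [D gD]; split=> [u v i a x y|].
  case: u => [|x0 [|x1 u]] /=; last 2 first.
  - by rewrite scaler0 addr0.
  - by rewrite scaler0 addr0.
  by case: v => [|y0 v]; rewrite ?scaler0 ?addr0 // gl.
by exists D => -[|z [|z' w]]; rewrite ?eqxx // wdeg1; apply: gD.
Qed.
Definition functional (g : letter -> k) Hg gD : tens := mktens (@functional_subproof g Hg gD).

Lemma functionalE (g : letter -> k) Hg gD w :
  @functional g Hg gD w = if w is [:: z] then g z else 0.
Proof. by []. Qed.
Lemma functional_arity (g : letter -> k) Hg gD : arity 1 (@functional g Hg gD).
Proof. by case=> [|z [|y w]] //; rewrite functionalE eqxx. Qed.

Fact first_slot_subproof x f : tens_mem (fun w => f (x :: w) : k^o).
Proof.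
have [fl [D fD]] := tensP f; split=> [u v i a y z|].
  by rewrite -!cat_cons fl.
exists [seq e - ldeg x | e <- D] => w /fD; rewrite wdeg_cons => wD.
by apply/mapP; exists (ldeg x + wdeg w) => //; rewrite addrAC subrr add0r.
Qed.
Definition first_slot x f : tens := mktens (first_slot_subproof x f).
Lemma first_slotE x f w : first_slot x f w = f (x :: w).
Proof. by []. Qed.

Definition unit_fun : word -> k^o := fun w => (size w == 0%N)%:R.
Fact unit_subproof : tens_mem unit_fun.
Proof.
split=> [u v i a x y|]; last first.
  apply: (@findegs_homog 0) => -[|x w]; rewrite ?eqxx // => _; exact: wdeg_nil.
by rewrite /unit_fun !size_cat /= !addnS scaler0 addr0.
Qed.
Definition tone : tens := mktens unit_subproof.
Lemma toneE w : tone w = (size w == 0%N)%:R.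
Proof. by []. Qed.
Lemma tone_homog : homog 0 tone.
Proof. by case=> [|x w]; rewrite toneE /= ?eqxx // wdeg_nil. Qed.
Lemma tmul1 f : tmul tone f = f.
Proof.
apply: tens_eq => w; rewrite tmul_deconc deconc_first; first by rewrite toneE mul1r.
by case=> [|x u] v // _ _; rewrite toneE mul0r.
Qed.

End Tensors.

(** * The non-degenerate form *)

Lemma linear_packed (k : fieldType) (U W : lmodType k) (h : U -> W) :
  linear h -> exists g : {linear U -> W}, g =1 h.
Proof.
move=> hl; pose L := GRing.isLinear.Build k U W *:%R h hl.
by pose g : {linear U -> W} := HB.pack h L; exists g.
Qed.

Section Pairing.
Variables (k : fieldType) (V : inv_graded k) (d : int) (B : sym_form V d).
Hypothesis nondeg : nondegenerate_form B.
Local Notation tens := (tens V).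
Local Notation letter := (letter V).
Local Notation word := (seq letter).
Local Notation sg := (sg k).
Implicit Types (f : tens).

Definition lpair (x y : letter) : k := B _ _ (tagged x) (tagged y).

Lemma lpair_linearl y : letter_linear (lpair^~ y).
Proof. by move=> i a x x'; rewrite /lpair /= linearPl. Qed.

Lemma lpair_linearr x : letter_linear (lpair x).
Proof. by move=> i a y y'; rewrite /lpair /= linearPr. Qed.

Lemma lpair_tag x y : lpair x y != 0 -> tag x + tag y = - d.
Proof. by move=> nz; apply/eqP; apply: contraNT nz => ne; rewrite /lpair pairing_deg. Qed.

Lemma lpair_sym x y : lpair x y = sg (tag x * tag y) * lpair y x.
Proof. exact: pairing_sym. Qed.

Lemma lpair_star x y : lpair (lstar x) (lstar y) = lpair x y.
Proof. exact: pairing_inv. Qed.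

Lemma lpair_represent i j (g : letter -> k) : letter_linear g -> i + j = - d ->
  exists v : V i, forall y : V j, B i j v y = g (lett y).
Proof.
move=> gl ij; have -> : j = - d - i by rewrite -ij addrC addKr.
have gl' : linear (fun y : V (- d - i) => g (lett y) : k^o).
  by move=> a x y; rewrite gl.
have [h hE] := linear_packed gl'.
by have [v [vE _]] := nondeg h; exists v => y; rewrite vE hE.
Qed.

Lemma lpair_injl i j (v v' : V i) : i + j = - d ->
  (forall y : V j, B i j v y = B i j v' y) -> v = v'.
Proof.
move=> ij; have -> : j = - d - i by rewrite -ij addrC addKr.
move=> vv; have [w [_ wu]] := nondeg (B i (- d - i) v').
by rewrite -(wu v) ?(wu v') // => y.
Qed.

Lemma lpair_representr i (g : letter -> k) : letter_linear g ->
  exists2 y, tag y = - d - i & forall z, tag z = i -> g z = lpair z y.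
Proof.
move=> gl; have ij : - d - i + i = - d by rewrite subrK.
have [y yE] := lpair_represent gl ij.
exists (lett (sg (i * (- d - i)) *: y)) => // -[i' z] /= zi; subst i'.
rewrite lpair_sym /= /lpair /= linearZl_LR /= yE.
by rewrite -[RHS]/(_ * (_ * _)) mulrA sg_sq mul1r.
Qed.

Fact bfun_findegs y :
  exists D : seq int, forall z, lpair z y != 0 -> ldeg z \in D.
Proof.
exists [:: 1 + d + tag y] => z /lpair_tag zy; rewrite inE /ldeg.
by apply/eqP; have -> : tag z = - d - tag y by [rewrite -zy addrK]; ring.
Qed.

(** The element of [Sigma^-1 V^*] defined by [y] through the form. *)
Definition bfun y : tens := functional (lpair_linearl y) (bfun_findegs y).

Lemma bfunE y z : bfun y [:: z] = lpair z y.
Proof. by []. Qed.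
Lemma bfun_arity y : arity 1 (bfun y).
Proof. exact: functional_arity. Qed.
Lemma bfun_homog y : homog (1 + d + tag y) (bfun y).
Proof.
case=> [|z [|z' w]]; rewrite /bfun functionalE ?eqxx //= => /lpair_tag zy.
by rewrite wdeg1 /ldeg; have -> : tag z = - d - tag y by [rewrite -zy addrK]; ring.
Qed.

Lemma lpair_separates i (v : V i) : v != 0 -> exists y : V (- d - i), B i _ v y = 1.
Proof.
move=> v0; have ij : i + (- d - i) = - d by rewrite addrC subrK.
have [y By] : exists y : V (- d - i), B i _ v y != 0.
  apply: contra_notP (negP v0) => no; apply/eqP; apply: (lpair_injl ij) => y.
  rewrite linear0l; apply/eqP; apply: contra_notT no => By; by exists y.
by exists ((B i _ v y)^-1 *: y); rewrite linearZr_LR /=; apply: mulVf.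
Qed.

(** By induction on [s]. If [P] fixes [s] and [e = v - P v] is not [0], choose [y]
  with [<e, y> = 1] and add to [P] the map [x |-> <x - P x, y> e]: it vanishes
  on [s] and sends [v] to [e]. The functional [x |-> <P x, y>] is itself of the
  form [<x, g>], so the new map is again given by vectors on both sides. No
  choice of a basis is involved. *)
Lemma finite_rank_projector i (s : seq (V i)) :
  exists K : seq (V (- d - i) * V i),
    forall v : V i, v \in s -> v = \sum_(q <- K) B i _ v q.1 *: q.2.
Proof.
elim: s => [|v s [K KE]]; first by exists [::].
pose P (x : V i) := \sum_(q <- K) B i _ x q.1 *: q.2.
have [e0|/lpair_separates[y y1]] := eqVneq (v - P v) 0.
  exists K => x; rewrite inE => /predU1P[->|/KE //].
  by apply/eqP; rewrite -subr_eq0 -/(P v) e0.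
have [g gE] : exists y' : V (- d - i), forall x, B i _ x y' = B i _ (P x) y.
  have ij : - d - i + i = - d by rewrite subrK.
  exists (\sum_(q <- K) B i _ q.2 y *: q.1) => x.
  rewrite linear_sumr /= [in RHS]/P linear_sumlz /=; apply: eq_bigr => q _.
  by rewrite linearZr_LR /= linearZl_LR; apply: mulrC.
exists ((y - g, v - P v) :: K) => x; rewrite big_cons -/(P x) /= linearBr /= gE.
rewrite -linearBl /= inE => /predU1P[->|/KE xE].
  by rewrite y1 scale1r subrK.
by rewrite -/(P x) in xE; rewrite -xE subrr linear0l scale0r add0r.
Qed.

(** A letter of the wrong degree is sent to [0]; this moves vectors between
  components whose degrees are only provably equal. *)
Definition cast_letter i (z : letter) : V i :=
  if tag z =P i is ReflectT e then ecast j (V j) e (tagged z) else 0.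
Lemma cast_letterE z : cast_letter (tag z) z = tagged z.
Proof.
rewrite /cast_letter; case: eqP => // e.
by rewrite (eq_irrelevance e (erefl (tag z))).
Qed.

(** Letters of different degrees are orthogonal to the vectors needed for one
  another, so the projectors of the finitely many degrees in [s] add up. *)
Lemma finite_rank_letters (s : seq letter) :
  exists2 K : seq (letter * letter),
    forall q, q \in K -> tag q.1 + tag q.2 = - d &
    forall (g : letter -> k), letter_linear g ->
    forall z, z \in s -> g z = \sum_(q <- K) lpair z q.1 * g q.2.
Proof.
pose Kof i := projT1 (cid (finite_rank_projector (map (cast_letter i) s))).
pose D := undup (map tag s).
exists [seq (lett q.1, lett q.2) | i <- D, q <- Kof i].
  by move=> _ /allpairsPdep[i [q [_ _ ->]]] /=; rewrite subrK.
move=> g gl z zs.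
rewrite big_allpairs_dep /= (bigD1_seq (tag z)) ?undup_uniq //=; last first.
  by rewrite mem_undup map_f.
rewrite [X in _ + X]big1 ?addr0 => [|i iz]; last first.
  apply: big1 => q _; suff -> : lpair z (lett q.1) = 0 by rewrite mul0r.
  apply/eqP; apply: contraNT iz => /lpair_tag /= zi; apply/eqP.
  by apply: (addIr (- d - i)); rewrite zi; ring.
rewrite [in LHS](letterE z) /Kof; case: cid => /= K /(_ (tagged z)).
rewrite -{1}cast_letterE map_f // => /(_ isT) {1}->.
by rewrite letter_linear_sum.
Qed.

End Pairing.

(** * Derivations are determined by their values in arity one *)

Section Derivations.
Variables (k : fieldType) (V : inv_graded k).
Local Notation tens := (tens V).
Local Notation letter := (letter V).
Local Notation word := (seq letter).
Local Notation sg := (sg k).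
Implicit Types (f g : tens) (xi eta : tens -> tens) (w : word).

Section LinearMaps.
Variables (xi : tens -> tens) (xil : linear xi).
Lemma lin0 : xi 0 = 0.
Proof. by have := xil (-1) 0 0; rewrite scaler0 addr0 scaleN1r addNr. Qed.
Lemma linZ a f : xi (a *: f) = a *: xi f.
Proof. by rewrite -[a *: f]addr0 xil lin0 addr0. Qed.
Lemma linD f g : xi (f + g) = xi f + xi g.
Proof. by rewrite -[f]scale1r xil !scale1r. Qed.
Lemma linB f g : xi (f - g) = xi f - xi g.
Proof. by rewrite addrC -scaleN1r xil scaleN1r addrC. Qed.
Lemma lin_sum (I : Type) (r : seq I) (P : pred I) (F : I -> tens) :
  xi (\sum_(i <- r | P i) F i) = \sum_(i <- r | P i) xi (F i).
Proof. by apply: (big_morph xi linD lin0). Qed.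
End LinearMaps.

Lemma tmul_linl (a : k) f g : tmul (a *: f) g = a *: tmul f g.
Proof. exact: (@linZ (fun f => tmul f g) (fun a f h => tmul_linearl a f h g)). Qed.
Lemma tmul_linr (a : k) f g : tmul f (a *: g) = a *: tmul f g.
Proof. exact: (@linZ (tmul f) (fun a g h => tmul_linearr a g h f)). Qed.
Lemma tmulDl f g h : tmul (f + g) h = tmul f h + tmul g h.
Proof. exact: (@linD (fun f => tmul f h) (fun a f g => tmul_linearl a f g h)). Qed.
Lemma tmulDr f g h : tmul h (f + g) = tmul h f + tmul h g.
Proof. exact: (@linD (tmul h) (fun a f g => tmul_linearr a f g h)). Qed.

Lemma derivation_scale p (c : k) xi : is_derivation p xi -> is_derivation p (c *: xi).
Proof.
case=> xl xd xL xc; have cE f : (c *: xi) f = c *: xi f by [].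
split=> [a f g|m f fm|m f g fm|m w]; rewrite ?cE.
- by rewrite xl scalerDr !scalerA [c * a]mulrC.
- by apply: homogZ; apply: xd.
- by rewrite (xL _ _ _ fm) tmul_linl tmul_linr scalerDr !scalerA [c * _]mulrC.
- by have [S HS] := xc m w; exists S => f fm f0; rewrite cE tensZE HS ?mulr0.
Qed.

Lemma der_unit p xi : is_derivation p xi -> xi (tone V) = 0.
Proof.
move=> D; have := der_leibniz D (tone V) (@tone_homog k V).
rewrite tmul1 mulr0 sg0 scale1r tmul1.
have -> : tmul (xi (tone V)) (tone V) = xi (tone V).
  apply: tens_eq => w; rewrite tmul_deconc deconc_last ?toneE ?mulr1 //.
  by move=> u [|y v] // _ _; rewrite toneE mulr0.
by rewrite -{1}[xi (tone V)]addr0 => /addrI.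
Qed.

(** The value at a word depends on finitely many values of a homogeneous
  argument, so it is enough to approximate the argument on finite sets of
  words. *)
Lemma continuous_agree xi eta m f : linear xi -> linear eta ->
  continuous_op xi -> continuous_op eta -> homog m f ->
  (forall S : seq word, exists g,
     [/\ homog m g, xi g = eta g & forall u, u \in S -> f u = g u]) ->
  xi f = eta f.
Proof.
move=> xl el xc ec fm approx; apply: tens_eq => w.
have [S HS] := xc m w; have [T HT] := ec m w.
have [g [gm xg fg]] := approx (S ++ T).
have fgm : homog m (f - g) by rewrite addrC -scaleN1r; apply: homog_lin.
have fg0 u : u \in S ++ T -> (f - g : tens) u = 0.
  by move=> uS; rewrite tensD tensN fg // subrr.
have -> : xi f w = xi g w.
  apply/eqP; rewrite -subr_eq0 -tensN -tensD -linB //; apply/eqP.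
  by apply: HS => // u uS; apply: fg0; rewrite mem_cat uS.
rewrite xg; apply/eqP; rewrite eq_sym -subr_eq0 -tensN -tensD -linB //; apply/eqP.
by apply: HT => // u uS; apply: fg0; rewrite mem_cat uS orbT.
Qed.

Variables (d : int) (B : sym_form V d).
Hypothesis nondeg : nondegenerate_form B.

(** The tensors on which [xi] and [eta] agree form a subalgebra containing the
  functionals [bfun B y]. On finitely many words a tensor [f] of arity [n + 1]
  is a finite sum of products of some [bfun B y] with a slot of [f], of arity
  [n]; by induction on [n] and continuity the subalgebra is everything. *)
Lemma der_unique p xi eta : is_derivation p xi -> is_derivation p eta ->
  (forall y, xi (bfun B y) = eta (bfun B y)) -> xi = eta.
Proof.
move=> Dx De xe.
have [[xl _ xL xc] [el _ eL ec]] := (Dx, De).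
have agree_mul m f g : homog m f -> xi f = eta f -> xi g = eta g ->
    xi (tmul f g) = eta (tmul f g).
  by move=> fm ff gg; rewrite (xL _ _ _ fm) (eL _ _ _ fm) ff gg.
have agree_arity n : forall m f, homog m f -> arity n f -> xi f = eta f.
  elim: n => [|n IH] m f fm fn.
    have -> : f = (f [::] : k) *: tone V.
      apply: tens_eq => -[|x w]; rewrite tensZE toneE /= ?mulr1 // mulr0.
      exact: (arity_eq0 fn).
    by rewrite !linZ // (der_unit Dx) (der_unit De).
  apply: (@continuous_agree _ _ m) => // S.
  have [K Kd KE] := finite_rank_letters nondeg (pmap ohead S).
  pose g : tens := \sum_(q <- K) tmul (bfun B q.1) (first_slot q.2 f).
  have slot_homog (q : letter * letter) : homog (m - ldeg q.2) (first_slot q.2 f).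
    by move=> w; rewrite first_slotE => /fm; rewrite wdeg_cons => <-; ring.
  exists g; split.
  - rewrite /g big_seq; apply: homog_sum => q /Kd tq.
    have -> : m = (1 + d + tag q.1) + (m - ldeg q.2).
      have -> : tag q.1 = - d - tag q.2 by rewrite -tq addrK.
      by rewrite /ldeg; ring.
    exact: tmul_homog (@bfun_homog _ _ _ _ _) (slot_homog q).
  - rewrite !lin_sum //; apply: eq_bigr => q _.
    apply: agree_mul (@bfun_homog _ _ _ _ _) (xe _) (IH _ _ (slot_homog q) _).
    by move=> w; rewrite first_slotE => /fn [].
  - move=> u uS; rewrite tens_sumE.
    case: u uS => [|x u] uS.
      rewrite (arity_eq0 fn) // big1 // => q _.
      by rewrite tmul_deconc deconc_nil /bfun functionalE mul0r.
    rewrite (KE (fun z => f (z :: u)) (tens_slot f [::] u)); last first.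
      by rewrite mem_pmap; apply/mapP; exists (x :: u).
    apply: eq_bigr => q _.
    rewrite tmul_deconc deconc_cons {1}/bfun functionalE mul0r add0r.
    rewrite deconc_first => [|[|y v] // t _ _]; last by rewrite /bfun functionalE mul0r.
    by rewrite bfunE first_slotE.
have agree_homog m f : homog m f -> xi f = eta f.
  move=> fm; apply: (@continuous_agree _ _ m) => // S.
  exists (\sum_(n < (\max_(u <- S) size u).+1) arity_part n f); split.
  - by apply: homog_sum => n _; apply: arity_part_homog.
  - rewrite !lin_sum //; apply: eq_bigr => n _.
    by apply: (agree_arity n m); [apply: arity_part_homog|apply: arity_part_arity].
  - move=> u uS; rewrite tens_sumE.
    have su : (size u < (\max_(u <- S) size u).+1)%N.
      by rewrite ltnS (big_rem u) //= leq_maxl.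
    rewrite (bigD1 (Ordinal su)) //= arity_partE eqxx mul1r big1 ?addr0 // => n nu.
    rewrite arity_partE; case: eqP => [un|_]; last by rewrite mul0r.
    by case/eqP: nu; apply: val_inj.
apply/funext => f; have [D ->] := homog_sum_degrees f.
by rewrite !lin_sum //; apply: eq_bigr => m _; apply: agree_homog (@degree_part_homog _ _ _ _).
Qed.
End Derivations.

(** * Derivations with prescribed values in arity one *)

Section MoreDeconcatenation.
Variables (k : fieldType) (T : eqType).
Implicit Types u v w t : seq T.

Lemma deconc_insert (G : seq T -> seq T -> k) u x t : deconc G (u ++ x :: t) =
  deconc (fun a b => G a (b ++ x :: t)) u + deconc (fun a b => G (u ++ x :: a) b) t.
Proof.
elim: u G => [|y u IH] G; first by rewrite deconc_nil deconc_cons.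
by rewrite /= !deconc_cons IH addrA.
Qed.

Lemma deconc_exchange (G : seq T -> seq T -> seq T -> seq T -> k) u v :
  deconc (fun a b => deconc (G a b) v) u = deconc (fun c e => deconc (fun a b => G a b c e) u) v.
Proof. exact: exchange_big. Qed.

Lemma deconcA4 (G : seq T -> seq T -> seq T -> seq T -> k) w :
  deconc (fun u r => deconc (fun v s => deconc (G u v) s) r) w =
  deconc (fun l t => deconc (fun u r => deconc (fun v a => G u v a t) r) l) w.
Proof. by under eq_deconc do rewrite deconcA; rewrite deconcA. Qed.

Lemma deconc_support (S : eqType) (c : seq T -> seq T -> seq S) w :
  exists s : seq S, forall u v, u ++ v = w -> {subset c u v <= s}.
Proof.
exists (flatten [seq c (take i w) (drop i w) | i <- iota 0 (size w).+1]) => u v uvw z zc.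
apply/flatten_mapP; exists (size u); last by rewrite -uvw take_size_cat // drop_size_cat.
by rewrite mem_iota add0n ltnS -uvw size_cat leq_addr.
Qed.

End MoreDeconcatenation.

Section Extension.
Variables (k : fieldType) (V : inv_graded k).
Local Notation tens := (tens V).
Local Notation letter := (letter V).
Local Notation word := (seq letter).
Local Notation sg := (sg k).
Implicit Types (f g : tens) (u v w t : word).

(** The transposes of the components of a derivation of degree [p], without any
  sign: the derivation sends a functional [phi] to [v |-> phi [:: h v]]. They
  differ from the maps [hat xi_n] by [hat_sign]. As values are letters, of which
  the degree is a property, equal degrees require no transport. Linearity in
  each slot is tested by functionals for the same reason. *)
Record derivation_data (p : int) := DerivationData {
  dd_fun :> word -> letter;
  dd_deg : forall v, ldeg (dd_fun v) = wdeg v - p;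
  dd_lin : forall g : letter -> k, letter_linear g -> multilinear (fun v => g (dd_fun v) : k^o)
}.

Variables (p : int) (h : derivation_data p).

(** The Leibniz rule moves the derivation past the factors evaluated on [u],
  whence the sign. *)
Definition ext_fun (f : word -> k) w : k :=
  deconc (fun u r => deconc (fun v t => sg (p * wdeg u) * f (u ++ h v :: t)) r) w.

Lemma ext_fun_neq0 (f : word -> k) w : ext_fun f w != 0 ->
  exists2 w', f w' != 0 & wdeg w = wdeg w' + p.
Proof.
move=> /deconc_neq0[u [r [-> /deconc_neq0[v [t [-> ]]]]]].
rewrite mulf_eq0 negb_or => /andP[_ nz]; exists (u ++ h v :: t) => //.
by rewrite !wdegE dd_deg; ring.
Qed.

Fact ext_subproof f : tens_mem (ext_fun f : word -> k^o).
Proof.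
have [fl [D fD]] := tensP f; split.
  apply: multilinear_deconc => [r|u].
    have -> : (fun u => deconc (fun v t => sg (p * wdeg u) * f (u ++ h v :: t)) r) =
        (fun u => sg (p * tot (ldegs u)) * deconc (fun v t => f (u ++ h v :: t)) r).
      by apply/funext => u; rewrite -deconcZ.
    apply: (multilinear_degs (fun s => sg (p * tot s))) => u1 u2 i a x y.
    rewrite scale_mulE -deconcZ -deconcD; apply: eq_deconc => v t _.
    by rewrite -!catA /= fl.
  apply: (@multilinear_deconc _ _ (fun v t => sg (p * wdeg u) * f (u ++ h v :: t))).
    move=> t u1 u2 i a x y.
    rewrite (dd_lin h (tens_slot f u t)).
    by rewrite mulrDr !scale_mulE mulrCA.
  move=> v u1 u2 i a x y; rewrite -!cat_cons !catA fl.
  by rewrite mulrDr !scale_mulE mulrCA.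
exists [seq e + p | e <- D] => w /ext_fun_neq0[w' /fD wD ->].
by apply/mapP; exists (wdeg w').
Qed.
Definition ext f : tens := mktens (ext_subproof f).
Lemma extE f w : ext f w = ext_fun f w. Proof. by []. Qed.

Lemma ext_arity1 f w : arity 1 f -> ext f w = f [:: h w].
Proof.
move=> f1; rewrite extE /ext_fun deconc_first => [|[|x u] r _ // _]; last first.
  rewrite -[RHS](deconc0 _ r); apply: eq_deconc => v t _.
  by rewrite (arity_eq0 f1) ?mulr0 //= size_cat addnS.
rewrite deconc_last => [|v [|x t] _ // _]; last by rewrite (arity_eq0 f1) ?mulr0.
by rewrite wdeg_nil mulr0 sg0 mul1r.
Qed.

Lemma ext_linear : linear ext.
Proof.
move=> a f g; apply: tens_eq => w; rewrite tensE !extE -deconcZ -deconcD.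
apply: eq_deconc => u r _; rewrite -deconcZ -deconcD; apply: eq_deconc => v t _.
by rewrite tensE mulrDr mulrCA.
Qed.

Lemma ext_derivation : is_derivation p ext.
Proof.
split; first exact: ext_linear.
- by move=> m f fm w; rewrite extE => /ext_fun_neq0[w' /fm <- ->].
- move=> m f g fm; apply: tens_eq => w; rewrite tensD tensZE extE !tmul_deconc.
  rewrite /ext_fun; under eq_deconc => u r _.
    under eq_deconc => v t _ do rewrite tmul_deconc deconc_insert mulrDr -!deconcZ.
    rewrite deconcD; over.
  rewrite deconcD addrC; congr (_ + _).
    rewrite deconcA4; apply: eq_deconc => l t _; rewrite -deconcMr.
    apply: eq_deconc => u r _; rewrite -deconcMr.
    by apply: eq_deconc => v a _; rewrite mulrA.
  pose H a b r := deconc (fun v t => sg (p * wdeg (a ++ b)) * (f a * g (b ++ h v :: t))) r.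
  transitivity (deconc (fun u r => deconc (fun a b => H a b r) u) w).
    apply: eq_deconc => u r _; rewrite deconc_exchange.
    by apply: eq_deconc => a b <-.
  rewrite -deconcA -deconcZ; apply: eq_deconc => a r _.
  rewrite extE -deconcZ -deconcZ; apply: eq_deconc => b s _.
  rewrite -!deconcZ; apply: eq_deconc => v t _.
  have [->|/fm <-] := eqVneq (f a) 0; first by rewrite !mul0r !mulr0.
  by rewrite wdeg_cat mulrDr sgD; ring.
- move=> m w.
  have [S HS] := deconc_support (fun u r =>
    [seq u ++ h (take j r) :: drop j r | j <- iota 0 (size r).+1]) w.
  exists S => f _ f0; rewrite extE -[RHS](deconc0 _ w); apply: eq_deconc => u r ur.
  rewrite -[RHS](deconc0 _ r); apply: eq_deconc => v t vt.
  rewrite f0 ?mulr0 //; apply: (HS u r) => //; apply/mapP; exists (size v).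
    by rewrite mem_iota add0n ltnS -vt size_cat /= leq_addr.
  by rewrite -vt take_size_cat ?drop_size_cat.
Qed.

End Extension.

(** * Rotations and reversal of words *)

Section Rotations.
Variables (k : fieldType) (V : inv_graded k).
Local Notation tens := (tens V).
Local Notation letter := (letter V).
Local Notation word := (seq letter).
Local Notation sg := (sg k).
Implicit Types (F : word -> k) (u v w t : word).

Definition rotf F w : k :=
  if w is x :: t then sg (ldeg x * wdeg t) * F (rcons t x) else F [::].
Definition starf F w : k :=
  sg (pair_sum (ldegs w) + (size w)%:Z) * F (rev (map (@lstar k V) w)).

Lemma trotE (f : tens) w : trot f w = rotf f w.
Proof. by case: w. Qed.

Lemma iter_trotE n (f : tens) w : iter n (@trot k V) f w = iter n rotf f w.
Proof. by elim: n w => // n IH w; rewrite /= trotE /=; case: w => [|x w] /=; rewrite IH. Qed.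

Lemma iter_rotf F u v :
  iter (size u) rotf F (u ++ v) = sg (wdeg u * wdeg v) * F (v ++ u).
Proof.
elim: u v => [|x u IH] v /=; first by rewrite wdeg_nil mul0r sg0 mul1r cats0.
rewrite rcons_cat IH cat_rcons mulrA; congr (_ * _).
by rewrite !wdegE; parity.
Qed.

Lemma eq_iter_rotf F F' n w : (forall w', size w' = size w -> F w' = F' w') ->
  iter n rotf F w = iter n rotf F' w.
Proof.
elim: n w => [|n IH] w FF /=; first exact: FF.
case: w FF => [|x w] FF /=; first by rewrite IH.
by rewrite IH // size_rcons.
Qed.

Lemma rotf_period F w : iter (size w) rotf F w = F w.
Proof. by rewrite -{2}(cats0 w) iter_rotf wdeg_nil mulr0 sg0 mul1r. Qed.

(** The norm of the cyclic groups. It acts on functions of words rather than on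
  tensors, because it is applied to sums over factorizations of a word into
  pieces of fixed lengths, in the proof of [cnorm_deconc_swap]. *)
Definition cnorm F w : k := \sum_(a < size w) iter a rotf F w.

Lemma eq_cnorm F F' w : (forall w', size w' = size w -> F w' = F' w') ->
  cnorm F w = cnorm F' w.
Proof. by move=> FF; apply: eq_bigr => a _; apply: eq_iter_rotf. Qed.

Lemma iter_rotf_sum n (I : Type) (r : seq I) (F : I -> word -> k) w :
  iter n rotf (fun w' => \sum_(i <- r) F i w') w = \sum_(i <- r) iter n rotf (F i) w.
Proof.
elim: n w => //= n IH [|x w]; first by rewrite /= IH.
by rewrite /= IH mulr_sumr.
Qed.

Lemma cnorm_sum (I : Type) (r : seq I) (F : I -> word -> k) w :
  cnorm (fun w' => \sum_(i <- r) F i w') w = \sum_(i <- r) cnorm (F i) w.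
Proof.
by rewrite /cnorm exchange_big; apply: eq_bigr => a _; rewrite iter_rotf_sum.
Qed.

Lemma iter_rotf_lin n c F F' w : iter n rotf (fun w' => c * F w' + F' w') w =
  c * iter n rotf F w + iter n rotf F' w.
Proof.
elim: n w => //= n IH [|x w] /=; first by rewrite IH.
by rewrite IH mulrDr mulrCA.
Qed.

Lemma cnorm_lin c F F' w :
  cnorm (fun w' => c * F w' + F' w') w = c * cnorm F w + cnorm F' w.
Proof.
by rewrite mulr_sumr -big_split; apply: eq_bigr => a _; rewrite iter_rotf_lin.
Qed.

Lemma cnorm0 w : cnorm (fun=> 0) w = 0.
Proof.
transitivity (cnorm (fun w' => \sum_(i <- [::] : seq unit) 0) w).
  by apply: eq_cnorm => w' _; rewrite big_nil.
by rewrite (cnorm_sum [::] (fun (_ : unit) _ => 0)) big_nil.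
Qed.

Lemma cnormZ c F w : cnorm (fun w' => c * F w') w = c * cnorm F w.
Proof.
rewrite -[RHS]addr0 -(cnorm0 w) -cnorm_lin.
by apply: eq_cnorm => w' _; rewrite addr0.
Qed.

(** [r^n] is the identity on words of length [n]. *)
Lemma sum_rotations F w n :
  \sum_(a < size w) iter (a + n) rotf F w = cnorm F w.
Proof.
elim: n => [|n <-]; first by apply: eq_bigr => a _; rewrite addn0.
case: (size w) (rotf_period (iter n rotf F) w) => [|N] per; first by rewrite !big_ord0.
rewrite big_ord_recr [RHS]big_ord_recl /= add0n addrC; congr (_ + _).
  by rewrite -per -iterD addSn addnS.
by apply: eq_bigr => a _; rewrite addnS.
Qed.

Lemma cnorm_iter n F w : cnorm (iter n rotf F) w = cnorm F w.
Proof. by rewrite -(sum_rotations F w n); apply: eq_bigr => a _; rewrite iterD. Qed.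

Lemma cnorm_rotf F w : cnorm (rotf F) w = cnorm F w.
Proof. exact: (cnorm_iter 1). Qed.

Lemma rotf_cnorm F : rotf (cnorm F) =1 cnorm F.
Proof.
case=> [|x w] //=; rewrite -(sum_rotations F (x :: w) 1) /cnorm size_rcons.
by rewrite mulr_sumr; apply: eq_bigr => a _; rewrite addn1.
Qed.

Definition cyc_inv F := forall u v, F (u ++ v) = sg (wdeg u * wdeg v) * F (v ++ u).

Lemma cyc_invP F : rotf F =1 F <-> cyc_inv F.
Proof.
split=> [FF u v|FF [|x w] //]; last by rewrite /= -cats1 -cat1s (FF [:: x]) wdeg1.
rewrite -iter_rotf; elim: (size u) (u ++ v) => //= n IH w.
by rewrite -FF /rotf; case: w => [|x w]; rewrite -IH.
Qed.

Lemma cyc_inv_cnorm F : cyc_inv (cnorm F).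
Proof. exact/cyc_invP/rotf_cnorm. Qed.

Lemma cyc_inv_iter F n w : cyc_inv F -> iter n rotf F w = F w.
Proof.
move=> /cyc_invP FF; elim: n w => //= n IH w.
by rewrite -FF /rotf; case: w => [|x w]; rewrite IH.
Qed.

Lemma cnorm_cyc_inv F w : cyc_inv F -> cnorm F w = (size w)%:R * F w.
Proof.
move=> FF; rewrite /cnorm; under eq_bigr do rewrite cyc_inv_iter //.
by rewrite sumr_const card_ord mulr_natl.
Qed.

Lemma cnorm_nil F : cnorm F [::] = 0.
Proof. exact: big_ord0. Qed.

Lemma cnorm_rcons F w y : cnorm F (rcons w y) =
  deconc (fun a b => sg (wdeg a * wdeg (rcons b y)) * F (rcons b y ++ a)) w.
Proof.
rewrite /cnorm /deconc size_rcons; apply: eq_bigr => i _.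
by rewrite -{2}(cat_take_drop i w) rcons_cat -iter_rotf size_takel // -ltnS.
Qed.

(** For each length of the first piece, exchanging the two pieces of the word is
  a rotation, under which the norm is invariant. *)
Lemma cnorm_deconc_swap (G : word -> word -> k) w :
  cnorm (fun w' => deconc G w') w =
  cnorm (fun w' => deconc (fun r u => sg (wdeg r * wdeg u) * G u r) w') w.
Proof.
pose N := size w.
transitivity (\sum_(i < N.+1) cnorm (fun w' => G (take i w') (drop i w')) w).
  by rewrite -cnorm_sum; apply: eq_cnorm => w' w'N; rewrite /deconc w'N.
transitivity (\sum_(i < N.+1) cnorm (fun w' =>
    sg (wdeg (take i w') * wdeg (drop i w')) * G (drop i w') (take i w')) w); last first.
  by rewrite -cnorm_sum; apply: eq_cnorm => w' w'N; rewrite /deconc w'N.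
rewrite [RHS](reindex_inj rev_ord_inj); apply: eq_bigr => i _ /=.
rewrite subSS -(cnorm_iter (N - i)); apply: eq_cnorm => w' w'N.
have iN : (i <= N)%N by rewrite -ltnS.
have sN : size (take (N - i) w') = (N - i)%N.
  by rewrite size_take w'N; case: ltnP => // le; apply/eqP; rewrite eqn_leq le leq_subr.
rewrite -{1}(cat_take_drop (N - i) w') -{1}sN iter_rotf; congr (_ * _).
have sD : size (drop (N - i) w') = i by rewrite size_drop w'N subKn.
by rewrite take_size_cat // drop_size_cat.
Qed.

Lemma eq_starf F F' w : (forall w', size w' = size w -> F w' = F' w') ->
  starf F w = starf F' w.
Proof. by move=> FF; rewrite /starf FF // size_rev size_map. Qed.

Lemma ldegs_star w : ldegs (map (@lstar k V) w) = ldegs w.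
Proof. by rewrite /ldegs -map_comp; apply: eq_map. Qed.
Lemma ldegs_rev w : ldegs (rev w) = rev (ldegs w).
Proof. exact: map_rev. Qed.
Lemma wdeg_rev w : wdeg (rev w) = wdeg w.
Proof. by rewrite /wdeg ldegs_rev; exact: tot_rev. Qed.
Lemma wdeg_star w : wdeg (map (@lstar k V) w) = wdeg w.
Proof. by rewrite /wdeg ldegs_star. Qed.
Lemma lstarK : involutive (@lstar k V).
Proof. by case=> i x; rewrite /lstar /= ginvK. Qed.
Lemma ldeg_star x : ldeg (@lstar k V x) = ldeg x. Proof. by []. Qed.

Lemma starfK F w : starf (starf F) w = F w.
Proof.
rewrite /starf map_rev revK -map_comp (eq_map lstarK) map_id mulrA.
rewrite ldegs_rev ldegs_star pair_sum_rev size_rev size_map.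
by rewrite sg_sq mul1r.
Qed.

Lemma pair_sum_rcons_cons (x : letter) w :
  pair_sum (ldegs (rcons w x)) = pair_sum (ldegs (x :: w)).
Proof.
rewrite /ldegs map_rcons pair_sum_rcons /= -cat1s pair_sum_cat.
by rewrite -[[:: ldeg x]]/(rcons [::] (ldeg x)) pair_sum_rcons pair_sum_nil tot_nil
  !tot_cons tot_nil; ring.
Qed.

(** The dihedral relation [r s r = s]. *)
Lemma rotf_starf_rotf F : rotf (starf (rotf F)) =1 starf F.
Proof.
case=> [|x w]; rewrite /rotf /starf //= map_rcons rev_rcons.
rewrite wdeg_rev wdeg_star ldeg_star rev_cons pair_sum_rcons_cons size_rcons.
rewrite mulrA mulrA; congr (_ * _); parity.
Qed.

Lemma cnorm_starf_rotf F w : cnorm (starf (rotf F)) w = cnorm (starf F) w.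
Proof. by rewrite -cnorm_rotf; apply: eq_cnorm => w' _; rewrite rotf_starf_rotf. Qed.

Lemma iter_starf n F w : iter n rotf (starf (iter n rotf F)) w = starf F w.
Proof.
elim: n F w => // n IH F w; rewrite iterS iterSr -rotf_starf_rotf.
by case: w => [|x w] /=; rewrite IH.
Qed.

(** By [s r^a = r^(n - a) s], reversal permutes the summands of the norm. *)
Lemma starf_cnorm F w : starf (cnorm F) w = cnorm (starf F) w.
Proof.
pose N := size w.
have -> : starf (cnorm F) w = \sum_(a < N) starf (iter a rotf F) w.
  by rewrite /starf /cnorm size_rev size_map mulr_sumr.
rewrite -(sum_rotations (starf F) w 1).
rewrite [RHS](reindex_inj rev_ord_inj); apply: eq_bigr => a _ /=.
have aN : (a <= N)%N by apply: ltnW.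
rewrite addn1 subnSK //.
transitivity (iter (N - a) rotf (iter a rotf (starf (iter a rotf F))) w); last first.
  by apply: eq_iter_rotf => w' _; rewrite iter_starf.
by rewrite -iterD subnK // rotf_period.
Qed.

End Rotations.

(** * The involution of derivations *)

Section StarDerivation.
Variables (k : fieldType) (V : inv_graded k).
Local Notation tens := (tens V).
Local Notation letter := (letter V).
Local Notation word := (seq letter).
Local Notation sg := (sg k).
Local Notation star := (map (@lstar k V)).
Implicit Types (f g : tens) (xi : tens -> tens).

Lemma tstar_starf f w : tstar f w = starf f w. Proof. by []. Qed.

Lemma tstarK f : tstar (tstar f) = f.
Proof. by apply: tens_eq => w; rewrite tstar_starf -[RHS]starfK. Qed.

Lemma tstar_homog m f : homog m f -> homog m (tstar f).
Proof.
move=> fm w; rewrite tstarE mulf_eq0 negb_or => /andP[_ /fm <-].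
by rewrite wdeg_rev wdeg_star.
Qed.

Lemma tstar_tmul m n f g : homog m f -> homog n g ->
  tstar (tmul f g) = sg (m * n) *: tmul (tstar g) (tstar f).
Proof.
move=> fm gn; apply: tens_eq => w.
rewrite tensZE !tmul_deconc tstarE tmul_deconc deconc_rev deconc_map -!deconcZ.
apply: eq_deconc => u v uv; rewrite !tstarE -uv.
have [->|/fm fv] := eqVneq (f (rev (star v))) 0; first by rewrite !(mul0r, mulr0).
have [->|/gn gu] := eqVneq (g (rev (star u))) 0; first by rewrite !(mul0r, mulr0).
rewrite wdeg_rev wdeg_star in fv; rewrite wdeg_rev wdeg_star in gu.
rewrite ldegs_cat pair_sum_cat !tot_ldegs fv gu size_cat.
transitivity (sg (m * n) * sg (pair_sum (ldegs u) + size u) *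
  sg (pair_sum (ldegs v) + size v) * (f (rev (star v)) * g (rev (star u)))); last by ring.
by congr (_ * _); rewrite PoszD; parity.
Qed.

Lemma dstar_derivation p xi : is_derivation p xi -> is_derivation p (dstar xi).
Proof.
case=> xl xd xL xc; split.
- by move=> a f g; rewrite /dstar tstar_linear xl tstar_linear.
- by move=> m f fm; apply/tstar_homog/xd/tstar_homog.
- move=> m f g fm; rewrite /dstar.
  have tl : linear (@tstar k V) by move=> a f1 f2; rewrite tstar_linear.
  have [D ->] := homog_sum_degrees g.
  elim: D => [|n D IH].
    rewrite !big_nil !(lin0 tl) !(lin0 xl) !(lin0 tl).
    have t0 h : tmul h 0 = 0 by apply: (@lin0 _ _ (tmul h)) => a f1 f2; exact: tmul_linearr.
    by rewrite !t0 scaler0 addr0 (lin0 tl) (lin0 xl) (lin0 tl).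
  rewrite !big_cons tmulDr !(linD tl) !(linD xl) !(linD tl) IH !tmulDr scalerDr.
  rewrite [RHS]addrACA; congr (_ + _).
  have gn : homog n (degree_part n g) by apply: degree_part_homog.
  move: (degree_part n g) gn => g' gn.
  rewrite (tstar_tmul fm gn) (linZ xl) (xL _ _ _ (tstar_homog gn)) (linZ tl) (linD tl) (linZ tl).
  rewrite (tstar_tmul (xd _ _ (tstar_homog gn)) (tstar_homog fm)).
  rewrite (tstar_tmul (tstar_homog gn) (xd _ _ (tstar_homog fm))) !tstarK.
  rewrite scalerDr !scalerA -!sgD [LHS]addrC; congr (_ + _).
    by rewrite -[RHS]scale1r -(sg0 k); congr (_ *: _); parity.
  by congr (_ *: _); parity.
- move=> m w; have [S HS] := xc m (rev (star w)).
  exists (map (fun u => rev (star u)) S) => f fm f0; rewrite /dstar tstarE.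
  rewrite (HS _ (tstar_homog fm)) ?mulr0 // => u uS.
  by rewrite tstarE f0 ?mulr0 //; apply/mapP; exists u.
Qed.

End StarDerivation.

(** * Hamiltonians of cyclic derivations *)

Section Hamiltonian.
Variables (k : fieldType) (V : inv_graded k) (d : int) (B : sym_form V d).
Hypothesis nondeg : nondegenerate_form B.
Local Notation tens := (tens V).
Local Notation letter := (letter V).
Local Notation word := (seq letter).
Local Notation sg := (sg k).
Local Notation lpair := (lpair B).
Local Notation bfun := (bfun B).
Implicit Types (f g : tens) (xi eta : tens -> tens).

(** The Hamiltonian of a derivation: the letter [y] of the functional [<-, y>] is
  appended to the words on which its image is evaluated. The sign depends on
  the degree of [y] alone for given [p]; its part [d * ldeg y] makes cyclicity
  invariance under rotation, and its part [d * p] is normalized so that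
  commutators with [m] acquire the sign of the suspended differential. *)
Definition ham p xi (w : word) : k :=
  if w is x :: t then
    sg (d * (ldeg (last x t) + p)) * xi (bfun (last x t)) (belast x t)
  else 0.

Lemma ham_rcons p xi w y :
  ham p xi (rcons w y) = sg (d * (ldeg y + p)) * xi (bfun y) w.
Proof. by case: w => [|x w] //=; rewrite last_rcons belast_rcons. Qed.

Lemma ham_inj p xi eta : is_derivation p xi -> is_derivation p eta ->
  ham p xi =1 ham p eta -> xi = eta.
Proof.
move=> Dx De he; apply: (der_unique nondeg Dx De) => y; apply: tens_eq => w.
have := he (rcons w y); rewrite !ham_rcons => /mulfI; apply; exact: sg_neq0.
Qed.

(** By non-degeneracy, the functional [G v] is the pairing with a vector, which
  depends linearly on each slot of [v] because [G] does and the form separates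
  vectors. *)
Lemma represent_data p (G : word -> letter -> k) :
  (forall y, multilinear (fun v => G v y : k^o)) ->
  (forall v, letter_linear (G v)) ->
  (forall v y, G v y != 0 -> wdeg v + ldeg y = p + (d + 1) + 1) ->
  exists h : derivation_data V p, forall v y, lpair (h v) y = G v y.
Proof.
move=> Gl Glet Gdeg.
have hex v : exists x, ldeg x = wdeg v - p /\ forall y, lpair x y = G v y.
  pose i : int := 1 - (wdeg v - p).
  have ij : i + (- d - i) = - d by rewrite addrC subrK.
  have [x xE] := lpair_represent nondeg (Glet v) ij.
  exists (lett x); split=> [|y]; first by rewrite /ldeg /= /i; ring.
  have [yd|yd] := eqVneq (tag y) (- d - i).
    by case: y yd => j y /= jE; subst j; rewrite /lpair /= xE.
  have -> : G v y = 0.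
    apply/eqP; apply: contraNT yd => /Gdeg; rewrite /ldeg => E.
    by apply/eqP; rewrite /i; lia.
  by apply/eqP; apply: contraNT yd => /lpair_tag /= <-; rewrite addrC addKr.
pose h v := projT1 (cid (hex v)).
have hdeg v : ldeg (h v) = wdeg v - p by rewrite /h; case: cid => x [].
have hE v y : lpair (h v) y = G v y by rewrite /h; case: cid => x [].
suff hl (g : letter -> k) : letter_linear g -> multilinear (fun v => g (h v) : k^o).
  by exists (DerivationData hdeg hl).
move=> gl u v i a x x'.
have [y _ gy] := lpair_representr nondeg (tag (h (u ++ lett x :: v))) gl.
have tagE x1 : tag (h (u ++ lett (x1 : V i) :: v)) = tag (h (u ++ lett x :: v)).
  apply: (addrI (- 1)); apply: oppr_inj; rewrite !opprD !opprK -!/(ldeg _) !hdeg.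
  by rewrite (wdeg_slot u v x1 x).
by rewrite !gy ?tagE // !hE Gl.
Qed.

Lemma bfun_linear i (a : k) (y y' : V i) :
  bfun (lett (a *: y + y')) = a *: bfun (lett y) + bfun (lett y').
Proof.
apply: tens_eq => -[|z [|z' w]]; rewrite tensE /bfun !functionalE ?mulr0 ?addr0 //.
by rewrite lpair_linearr.
Qed.

Lemma derivation_deg p xi y w : is_derivation p xi -> xi (bfun y) w != 0 ->
  wdeg w + ldeg y = p + (d + 1) + 1.
Proof.
move=> D /(der_deg D (@bfun_homog _ _ _ B y)) ->; rewrite /ldeg; ring.
Qed.

Lemma derivation_has_data p xi : is_derivation p xi ->
  exists h : derivation_data V p, forall y v, xi (bfun y) v = lpair (h v) y.
Proof.
move=> D; have [|v i a y y'|v y|h hE] := @represent_data p (fun v y => xi (bfun y) v).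
- by move=> y; case: (tensP (xi (bfun y))).
- by rewrite bfun_linear (der_linear D) tensE.
- exact: derivation_deg.
by exists h => y v; rewrite hE.
Qed.

Lemma derivation_extE p xi (h : derivation_data V p) : is_derivation p xi ->
  (forall y v, xi (bfun y) v = lpair (h v) y) -> xi = ext h.
Proof.
move=> Dx xh; apply: (der_unique nondeg Dx (ext_derivation h)) => y.
apply: tens_eq => v; rewrite ext_arity1; last exact: bfun_arity.
by rewrite xh bfunE.
Qed.

Lemma ham_homog p xi w : is_derivation p xi -> ham p xi w != 0 ->
  wdeg w = p + (d + 1) + 1.
Proof.
case/lastP: w => [|w y] D; first by rewrite eqxx.
rewrite ham_rcons mulf_eq0 negb_or wdeg_rcons => /andP[_]; exact: derivation_deg.
Qed.

Lemma ham_tens p xi : is_derivation p xi -> tens_mem (ham p xi : word -> k^o).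
Proof.
move=> D; split; last by apply: findegs_homog => w; apply: ham_homog.
move=> u v i a x x'; case/lastP: v => [|v y].
  by rewrite !cats1 !ham_rcons bfun_linear (der_linear D) tensE mulrDr scale_mulE mulrCA.
rewrite -!rcons_cons -!rcons_cat !ham_rcons; case: (tensP (xi (bfun y))) => -> _.
by rewrite mulrDr !scale_mulE mulrCA.
Qed.

Lemma wdeg_tagsum (w : word) : wdeg w = (size w)%:Z - tagsum w.
Proof.
rewrite /tagsum /tags; elim: w => [|x w IH]; first by rewrite wdeg_nil big_nil.
by rewrite wdeg_cons IH /= big_cons /ldeg -add1n PoszD; ring.
Qed.

Lemma hat_deg_ldeg p (w : word) i : i = hat_deg p w <-> 1 - i = wdeg w - p.
Proof. by rewrite /hat_deg wdeg_tagsum; split; lia. Qed.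

Definition pos (w : word) : int :=
  \sum_(i < size w) (size w - i.+1)%:Z * (tags w)`_i.

Lemma pos_rcons (w : word) z : pos (rcons w z) = pos w + tagsum w.
Proof.
rewrite /pos size_rcons big_ord_recr /= subnn mul0r addr0.
rewrite /tagsum (big_nth 0) size_map big_mkord -big_split /=; apply: eq_bigr => i _.
rewrite /tags map_rcons nth_rcons size_map ltn_ord subSS.
by rewrite -(subnSK (ltn_ord i)) -add1n PoszD mulrDl mul1r addrC.
Qed.

Lemma pos_cons y (w : word) : pos (y :: w) = (size w)%:Z * tag y + pos w.
Proof. by rewrite /pos /= big_ord_recl /= subn1; congr (_ + _). Qed.

Lemma tagsum_rcons (w : word) z : tagsum (rcons w z) = tagsum w + tag z :> int.
Proof. by rewrite /tagsum /tags map_rcons -cats1 big_cat /= big_seq1. Qed.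

Lemma hat_signE p (w : word) : hat_sign p w = sg (p * (wdeg w - p) + pair_sum (ldegs w) + pos w).
Proof. by []. Qed.

(** The signs [hat_sign] and that of [ham] turn the sign of the cyclicity
  condition into the Koszul sign of a rotation. The pair sums of [u z] and [y u]
  differ by the terms of [z] and of [y] with [u] only, so they leave no trace
  of the interactions inside [u]. The hypothesis on degrees holds whenever the
  pairings in the cyclicity condition do not vanish. *)
Lemma cyclic_sign p (u : word) (z y : letter) (w := rcons u z) :
  hat_deg p w + tag y = - d ->
  sg (d * (ldeg z + p)) * hat_sign p (y :: u) =
  sg (ldeg y * wdeg w) * sg (d * (ldeg y + p)) * hat_sign p w
    * sg (tag y * tagsum w + (size w)%:Z).
Proof.
move=> dE; have -> : d = - (hat_deg p w + tag y) by [rewrite dE opprK].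
rewrite !hat_signE /w pos_rcons pos_cons.
rewrite -pair_sum_rcons_cons /ldegs !map_rcons !pair_sum_rcons -/(ldegs u) tot_ldegs.
rewrite /hat_deg !wdegE !wdeg_tagsum tagsum_rcons size_rcons /ldeg -!sgD.
by apply: sg_eq; rewrite ?oddzE; case_parity.
Qed.

Lemma cyclic_word p xi (h : forall w, V (hat_deg p w)) u z y (w := rcons u z) :
  is_hat xi h ->
  B _ _ (h w) (tagged y) =
    sg (tag y * tagsum w + (size w)%:Z) * B _ _ (h (y :: u)) (tagged z)
  <-> ham p xi (y :: w) = sg (ldeg y * wdeg w) * ham p xi (rcons w y).
Proof.
move=> hE; rewrite -[B _ _ (h w) _]/(lpair (lett (h w)) y).
rewrite -[B _ _ (h (y :: u)) _]/(lpair (lett (h (y :: u))) z).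
have -> : y :: w = rcons (y :: u) z by [].
rewrite !ham_rcons !hE; try exact: bfun_arity.
rewrite !bfunE; set b := lpair _ y; set b' := lpair _ z.
have [dE|dN] := eqVneq (hat_deg p w + tag y) (- d).
  rewrite !mulrA (cyclic_sign dE) -!mulrA.
  have sN c : sg (ldeg y * wdeg w) * (sg (d * (ldeg y + p)) * (hat_sign p w * c)) =
      (sg (ldeg y * wdeg w) * sg (d * (ldeg y + p)) * hat_sign p w) * c by rewrite !mulrA.
  have c0 : sg (ldeg y * wdeg w) * sg (d * (ldeg y + p)) * hat_sign p w != 0.
    by rewrite !mulf_neq0 ?sg_neq0.
  rewrite !sN; split=> [->|/(mulfI c0) <-] //.
have -> : b = 0 by apply/eqP; apply: contraNT dN => /lpair_tag ->.
have -> : b' = 0; last by rewrite !mulr0.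
apply/eqP; apply: contraNT dN => /lpair_tag /= <-.
rewrite /hat_deg /w tagsum_rcons size_rcons /= /tagsum /= big_cons -/(tags u).
by apply/eqP; ring.
Qed.

Lemma ham_cyc_inv p xi : is_cyclic B p xi -> cyc_inv (ham p xi).
Proof.
case=> h [hE hC]; apply/cyc_invP => -[|y w] //.
case/lastP: w => [|u z]; first by rewrite /= wdeg_nil mulr0 sg0 mul1r.
exact/esym/(cyclic_word u z y hE)/hC.
Qed.

Lemma cast_letter_lett i (z : letter) : tag z = i -> lett (cast_letter i z) = z.
Proof. by move=> <-; rewrite cast_letterE -letterE. Qed.

Lemma cyc_inv_cyclic p xi : is_derivation p xi ->
  cyc_inv (ham p xi) -> is_cyclic B p xi.
Proof.
move=> D inv; have [hd hdE] := derivation_has_data D.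
have xh f w : arity 1 f -> xi f w = f [:: hd w].
  by move=> f1; rewrite (derivation_extE D hdE) ext_arity1.
pose h w : V (hat_deg p w) := hat_sign p w *: cast_letter (hat_deg p w) (hd w).
have hE : is_hat xi h.
  move=> f f1 w; rewrite (letter_linearZ _ _ (tens_slot f [::] [::])) mulrA.
  rewrite sg_sq mul1r /= cast_letter_lett ?xh //.
  by apply/hat_deg_ldeg; rewrite -/(ldeg _) dd_deg.
exists h; split=> // u z y; apply/(cyclic_word u z y hE).
by rewrite -cat1s inv wdeg1 cats1.
Qed.

(** Non-degeneracy provides letters [h v] with [<h v, y> = F (v y)] up to the
  sign of [ham]; their extension is the required derivation. *)
Lemma ham_surj p (F : tens) : homog (p + (d + 1) + 1) F -> F [::] = 0 -> cyc_inv F ->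
  exists xi, [/\ is_derivation p xi, is_cyclic B p xi & ham p xi =1 F].
Proof.
move=> Fh F0 Finv; have [Fl _] := tensP F.
have [y u v i a x x'|v i a y y'|v y|hd hdE] :=
    @represent_data p (fun v y => sg (d * (ldeg y + p)) * F (rcons v y)).
- by rewrite !rcons_cat !rcons_cons Fl mulrDr !scale_mulE mulrCA.
- by rewrite -!cats1 Fl mulrDr scale_mulE mulrCA.
- by rewrite mulf_eq0 negb_or => /andP[_ /Fh]; rewrite wdeg_rcons.
exists (ext hd); have Dx := ext_derivation hd.
have hamE : ham p (ext hd) =1 F.
  move=> w; case/lastP: w => [|v y]; first by rewrite F0.
  rewrite ham_rcons ext_arity1 ?bfunE; last exact: bfun_arity.
  by rewrite hdE mulrA sg_sq mul1r.
split=> //; apply: cyc_inv_cyclic => // u v; by rewrite !hamE.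
Qed.

Lemma tstar_bfun y : tstar (bfun y) = - bfun (lstar y).
Proof.
apply: tens_eq => -[|z [|z' w]]; rewrite tensN tstarE.
- by rewrite (arity_eq0 (@bfun_arity _ _ _ B y)) // (arity_eq0 (@bfun_arity _ _ _ B _)) // mulr0 oppr0.
- rewrite /= bfunE [bfun _ _]bfunE -(lpair_star B (lstar z)) lstarK.
  rewrite -[[:: ldeg z]]/(rcons [::] (ldeg z)) pair_sum_rcons pair_sum_nil tot_nil mul0r !add0r.
  exact: mulN1r.
rewrite (arity_eq0 (@bfun_arity _ _ _ B y)) ?(arity_eq0 (@bfun_arity _ _ _ B _)) // ?mulr0 ?oppr0 //.
by rewrite size_rev size_map.
Qed.

(** The dual of the involution carries a sign, [phi^* (v) = - phi (v^* )]: it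
  compensates the sign of the additional letter [y] in the reversal of words.
  Reversal moves [y] to the front, and invariance under rotation brings it back
  to the end. *)
Lemma ham_dstar p xi : is_derivation p xi -> cyc_inv (ham p xi) ->
  ham p (dstar xi) =1 starf (ham p xi).
Proof.
move=> Dx inv w; case/lastP: w => [|v y]; first by rewrite /starf /= mulr0.
rewrite ham_rcons /dstar tstarE tstar_bfun -scaleN1r (linZ (der_linear Dx)) tensZE.
rewrite /starf map_rcons rev_rcons -cat1s inv cats1 ham_rcons wdeg1 wdeg_rev wdeg_star.
rewrite !ldeg_star pair_sum_rcons_cons size_rcons /ldegs /= -cat1s pair_sum_cat -/(ldegs v).
rewrite -[[:: _]]/(rcons [::] (ldeg y)) pair_sum_rcons pair_sum_nil !tot_nil !tot_ldegs.
rewrite -[-1 : k]/(sg 1) !mulrA; congr (_ * _).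
rewrite -cats1 tot_cat tot_cons tot_nil; parity.
Qed.

End Hamiltonian.

(** * Hamiltonians of commutators *)

Section Bracket.
Variables (k : fieldType) (V : inv_graded k).
Local Notation tens := (tens V).
Local Notation letter := (letter V).
Local Notation word := (seq letter).
Local Notation sg := (sg k).
Implicit Types (f g : tens) (xi eta : tens -> tens).

Lemma bracket_derivation p q xi eta :
  is_derivation p xi -> is_derivation q eta -> is_derivation (p + q) (bracket p q xi eta).
Proof.
move=> Dx De; have [[xl xd xL xc] [el ed eL ec]] := (Dx, De).
have comp_homog r s (x1 x2 : tens -> tens) m f : is_derivation r x1 -> is_derivation s x2 ->
    homog m f -> homog (m + (s + r)) (x1 (x2 f)).
  by move=> D1 D2 fm; rewrite addrA; apply/(der_deg D1)/(der_deg D2).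
have comp_cont (x1 x2 : tens -> tens) r : is_derivation r x2 ->
    continuous_op x1 -> continuous_op (x1 \o x2).
  move=> D2 c1 m w; have [S HS] := c1 (m + r) w.
  have {c1} [T HT] : exists T : seq word, forall f, homog m f ->
      (forall u, u \in T -> f u = 0) -> forall u, u \in S -> x2 f u = 0.
    elim: S {HS} => [|u S [T HT]]; first by exists [::].
    have [T' HT'] := der_cont D2 m u; exists (T' ++ T) => f fm f0 v.
    rewrite inE => /predU1P[->|vS]; first by apply: HT' => // t tT; apply: f0; rewrite mem_cat tT.
    by apply: HT => // t tT; apply: f0; rewrite mem_cat tT orbT.
  exists T => f fm f0; apply: HS; first exact: der_deg D2 _ _ fm.
  exact: HT.
split.
- move=> a f g; rewrite /bracket el xl xl el scalerBr scalerDr opprD !scalerA.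
  by rewrite [a * _]mulrC addrACA.
- move=> m f fm; have -> : bracket p q xi eta f = - sg (p * q) *: eta (xi f) + xi (eta f).
    by rewrite /bracket addrC scaleNr.
  apply: homog_lin; last by rewrite [p + q]addrC; exact: comp_homog Dx De fm.
  exact: comp_homog De Dx fm.
- move=> m f g fm; rewrite /bracket (eL _ _ _ fm) (xL _ _ _ fm).
  rewrite !(linD xl, linD el, linZ xl, linZ el).
  rewrite (xL _ _ _ fm) (eL _ _ _ fm) (xL _ _ _ (ed _ _ fm)) (eL _ _ _ (xd _ _ fm)).
  apply: tens_eq => w; rewrite !(tmulDr, tmulDl, tmul_linl, tmul_linr, tensD, tensN, tensZE).
  rewrite -!scaleN1r !(tmul_linl, tmul_linr, tensZE).
  rewrite !mulrDr !mulrDl !sgD.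
  have e1 : sg (p * q) * sg (p * q) = 1 by rewrite sg_sq.
  rewrite [q * p]mulrC.
  rewrite scale_mulE. by ring: e1.
- move=> m w; have [S HS] := comp_cont _ _ _ De xc m w.
  have [T HT] := comp_cont _ _ _ Dx ec m w.
  exists (S ++ T) => f fm f0; rewrite /bracket tensD tensN tensZE.
  rewrite [xi _ _](HS f fm) ?[eta _ _](HT f fm) ?mulr0 ?subr0 // => u uS;
    by apply: f0; rewrite mem_cat uS ?orbT.
Qed.

Lemma dstar_bracket p q xi eta : linear eta -> linear xi ->
  dstar (bracket p q xi eta) = bracket p q (dstar xi) (dstar eta).
Proof.
move=> el xl; apply/funext => f; rewrite /dstar /bracket !tstarK.
have tl : linear (@tstar k V) by move=> a f1 f2; rewrite tstar_linear.
by rewrite (linB tl) (linZ tl).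
Qed.

Variables (q : int) (h : derivation_data V q).

(** The part of a derivation which absorbs an initial piece of the word. The
  other parts are obtained from it by rotating the word. *)
Definition head_der (F : word -> k) (w : word) : k := deconc (fun v r => F (h v :: r)) w.

Lemma cnorm_cons (F : word -> k) x w : cnorm F (x :: w) =
  deconc (fun t u => sg ((ldeg x + wdeg t) * wdeg u) * F (u ++ x :: t)) w.
Proof.
rewrite -cat1s cyc_inv_cnorm cats1 cnorm_rcons -deconcZ; apply: eq_deconc => a b abw.
rewrite mulrA cat_rcons; congr (_ * _).
by rewrite -abw !wdegE; parity.
Qed.

(** A piece [v] of [u v t] is initial in [v t u]. Rotating all words accordingly
  gives the sum over the rotations of [f] inside, that is, the norm of [f]. *)
Lemma cnorm_ext (f : tens) w : cnorm (ext h f) w = cnorm (head_der (cnorm f)) w.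
Proof.
rewrite (cnorm_deconc_swap (fun u r =>
  deconc (fun v t => sg (q * wdeg u) * f (u ++ h v :: t)) r)).
apply: eq_cnorm => w' _; rewrite /head_der.
pose K v t u := sg ((wdeg v - q + wdeg t) * wdeg u) * f (u ++ h v :: t).
transitivity (deconc (fun r u => deconc (fun v t => K v t u) r) w').
  apply: eq_deconc => r u _; rewrite -deconcZ; apply: eq_deconc => v t <-.
  by rewrite /K !mulrA; congr (_ * _); rewrite wdeg_cat; parity.
by rewrite -deconcA; apply: eq_deconc => v r _; rewrite cnorm_cons dd_deg.
Qed.

End Bracket.

Section HamiltonianBracket.
Variables (k : fieldType) (V : inv_graded k) (d : int) (B : sym_form V d).
Hypothesis nondeg : nondegenerate_form B.
Local Notation tens := (tens V).
Local Notation letter := (letter V).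
Local Notation word := (seq letter).
Local Notation sg := (sg k).
Local Notation lpair := (lpair B).
Local Notation bfun := (bfun B).
Local Notation ham := (ham B).
Implicit Types (f g : tens) (xi eta : tens -> tens).

(** The right-hand side is the sum over the places of the cyclic word [w y] at
  which the components of [eta] can absorb a piece. The pieces which avoid [y]
  are those of [eta (xi phi_y)]. A piece [v = c y a] with complement [b]
  contributes the pairing of the hats of [v] and [b]; exchanging the two
  sides of this pairing, by symmetry of the form and rotation of the
  Hamiltonian of [eta], gives the contribution of [b] to [xi (eta phi_y)]. *)
Lemma ham_bracket p q xi eta (hx : derivation_data V p) (he : derivation_data V q) :
  is_derivation p xi -> is_derivation q eta ->
  (forall y v, xi (bfun y) v = lpair (hx v) y) ->
  (forall y v, eta (bfun y) v = lpair (he v) y) ->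
  cyc_inv (ham p xi) -> cyc_inv (ham q eta) ->
  forall w, ham (q + p) (bracket q p eta xi) w =
    sg (d * q) * cnorm (head_der he (ham p xi)) w.
Proof.
move=> Dx De xE eE Fc Mc w; case/lastP: w => [|w y]; first by rewrite cnorm_nil mulr0.
set F := ham p xi in Fc *; set M := ham q eta in Mc *.
have FE v z : F (rcons v z) = sg (d * (ldeg z + p)) * lpair (hx v) z.
  by rewrite /F ham_rcons xE.
have ME v z : M (rcons v z) = sg (d * (ldeg z + q)) * lpair (he v) z.
  by rewrite /M ham_rcons eE.
rewrite ham_rcons /bracket tensD tensN tensZE cnorm_rcons.
have xF v z : xi (bfun z) v = sg (d * (ldeg z + p)) * F (rcons v z).
  by rewrite /F ham_rcons mulrA sg_sq mul1r.
have eM v z : eta (bfun z) v = sg (d * (ldeg z + q)) * M (rcons v z).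
  by rewrite /M ham_rcons mulrA sg_sq mul1r.
have eext X : eta X w = ext_fun he X w by rewrite (derivation_extE nondeg De eE).
have xext X : xi X w = ext_fun hx X w by rewrite (derivation_extE nondeg Dx xE).
rewrite eext xext mulrDr -(deconcZ (sg (d * q))).
under [RHS]eq_deconc => a b _.
  rewrite /head_der cat_rcons deconc_insert mulrDr mulrDr -!deconcZ; over.
rewrite deconcD; congr (_ + _).
  rewrite /ext_fun -deconcZ; apply: eq_deconc => a b _.
  rewrite -!deconcZ; apply: eq_deconc => v t vt.
  rewrite xF -vt.
  have -> : rcons (a ++ he v :: t) y = a ++ he v :: rcons t y by rewrite rcons_cat.
  rewrite Fc cat_cons cat_rcons !mulrA; congr (_ * _).
  by rewrite !wdegE dd_deg; parity.
pose K a b c := sg (d * q) * (sg (wdeg (a ++ b) * wdeg (rcons c y)) *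
  F (he (c ++ y :: a) :: b)).
transitivity (deconc (fun l c => deconc (fun a b => K a b c) l) w); last first.
  apply: eq_deconc => l c _.
  by apply: eq_deconc => a b <-.
rewrite -deconcA -mulNr mulrA /ext_fun -deconcZ; apply: eq_deconc => a r _.
rewrite -deconcZ; apply: eq_deconc => b c _; rewrite /K.
set v := c ++ y :: a; set x := hx b; set z := he v.
have -> : F (z :: b) = sg (ldeg z * wdeg b) *
    (sg (d * (ldeg z + p)) * (sg (tag x * tag z) * lpair z x)).
  by rewrite -cat1s Fc wdeg1 cats1 FE (lpair_sym B x).
have -> : eta (bfun y) (a ++ x :: c) = sg (d * (ldeg y + q)) *
    (sg ((wdeg a + ldeg x) * (wdeg c + ldeg y)) * (sg (d * (ldeg x + q)) * lpair z x)).
  rewrite eM; congr (_ * _).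
  have -> : rcons (a ++ x :: c) y = rcons a x ++ rcons c y.
    by rewrite rcons_cat cat_rcons.
  rewrite Mc !wdeg_rcons; congr (_ * _).
  by rewrite -ME /v cat_rcons rcons_cat.
have [->|/lpair_tag zx] := eqVneq (lpair z x) 0; first by rewrite !mulr0.
rewrite !mulrA; congr (_ * _).
have dz : d = - (tag z + tag x) by rewrite zx opprK.
have tx : tag x = 1 - (wdeg b - p) by rewrite -(dd_deg hx) /ldeg; ring.
have tz : tag z = 1 - (wdeg v - q) by rewrite -(dd_deg he) /ldeg; ring.
rewrite -[- sg _]mulN1r -[-1 : k]/(sg 1) dz /ldeg tx tz /v !wdegE /ldeg -!sgD.
by apply: sg_eq; rewrite ?oddzE; case_parity.
Qed.
End HamiltonianBracket.

(** * Coinvariants and invariants of the dihedral groups *)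

Section DihedralNorm.
Variables (k : fieldType) (V : inv_graded k) (b : bool).
Local Notation tens := (tens V).
Local Notation letter := (letter V).
Local Notation word := (seq letter).
Local Notation sg := (sg k).
Implicit Types (f g : tens) (F : word -> k).

(** The two elements [1] and [s] of a dihedral group represent the cosets of its
  rotations, so the norm factors through [symm]. *)
Definition symm F w : k := (-1) ^+ b * starf F w + F w.
Definition dnorm F w : k := cnorm (symm F) w.

Lemma signb_sq : (-1) ^+ b * (-1) ^+ b = 1 :> k.
Proof. by rewrite -signr_addb addbb. Qed.

Lemma eq_symm F F' w : (forall w', size w' = size w -> F w' = F' w') ->
  symm F w = symm F' w.
Proof. by move=> FF; rewrite /symm FF // (eq_starf FF). Qed.

Lemma eq_dnorm F F' w : (forall w', size w' = size w -> F w' = F' w') ->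
  dnorm F w = dnorm F' w.
Proof.
move=> FF; apply: eq_cnorm => w' ww; apply: eq_symm => u uw; apply: FF; by rewrite uw.
Qed.

Lemma symm_lin c F F' w :
  symm (fun w => c * F w + F' w) w = c * symm F w + symm F' w.
Proof. by rewrite /symm /starf; ring. Qed.

Lemma dnorm_lin c F F' w :
  dnorm (fun w => c * F w + F' w) w = c * dnorm F w + dnorm F' w.
Proof.
rewrite /dnorm -cnorm_lin; apply: eq_cnorm => w' _; exact: symm_lin.
Qed.

Lemma dnormE F w : dnorm F w = (-1) ^+ b * cnorm (starf F) w + cnorm F w.
Proof. by rewrite /dnorm -cnorm_lin. Qed.

Lemma dnormZ c F w : dnorm (fun w' => c * F w') w = c * dnorm F w.
Proof.
by rewrite /dnorm -cnormZ; apply: eq_cnorm => w' _; rewrite /symm /starf; ring.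
Qed.

Lemma dnorm_tens_lin (c : k) f g w :
  dnorm (Defs.tval (c *: f + g)) w = c * dnorm f w + dnorm g w.
Proof. by rewrite -dnorm_lin; apply: eq_dnorm => w' _; rewrite tensE. Qed.

Lemma dnorm_tens0 w : dnorm (Defs.tval (0 : tens)) w = 0.
Proof.
rewrite -(mul0r (dnorm (fun=> 0) w)) -dnormZ.
by apply: eq_dnorm => w' _; rewrite mul0r.
Qed.

Lemma dnorm_rotf F w : dnorm (rotf F) w = dnorm F w.
Proof. by rewrite !dnormE cnorm_starf_rotf cnorm_rotf. Qed.

Lemma dnorm_starf F w : dnorm (fun w' => (-1) ^+ b * starf F w') w = dnorm F w.
Proof.
rewrite dnormZ !dnormE mulrDr mulrA signb_sq mul1r addrC; congr (_ + _).
by apply: eq_cnorm => w' _; exact: starfK.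
Qed.

Lemma dnorm_dih_act a e f w : dnorm (dih_act b a e f) w = dnorm f w.
Proof.
transitivity (dnorm (Defs.tval (if e then (-1) ^+ b *: tstar f else f)) w); last first.
  by case: e => //; exact: dnorm_starf.
rewrite /dih_act; move: (if e then _ else _) => g; elim: a => // a <-.
by rewrite -[RHS]dnorm_rotf; apply: eq_dnorm => w' _; rewrite -trotE.
Qed.

Lemma dnorm_orbit_sum f w :
  dnorm f w = \sum_(a < size w) \sum_e dih_act b a e f w.
Proof.
apply: eq_bigr => a _; rewrite big_bool /dih_act !iter_trotE.
have := iter_rotf_lin a 1 (Defs.tval ((-1) ^+ b *: tstar f)) f w.
rewrite mul1r => E; apply: etrans E.
by apply: eq_iter_rotf => w' _; rewrite mul1r.
Qed.

Lemma cyc_inv_dnorm F : cyc_inv (dnorm F).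
Proof. exact: cyc_inv_cnorm. Qed.

Lemma starf_dnorm F w : starf (dnorm F) w = (-1) ^+ b * dnorm F w.
Proof.
rewrite /dnorm starf_cnorm -cnormZ; apply: eq_cnorm => w' _.
have -> : starf (symm F) w' = (-1) ^+ b * starf (starf F) w' + starf F w'.
  by rewrite /symm /starf; ring.
by rewrite starfK /symm mulrDr mulrA signb_sq mul1r addrC.
Qed.

Lemma dnorm_invariant F w : cyc_inv F -> starf F =1 (fun w => (-1) ^+ b * F w) ->
  dnorm F w = (2 * size w)%:R * F w.
Proof.
move=> Fc Fs; rewrite dnormE (eq_cnorm (F' := fun w => (-1) ^+ b * F w)) // cnormZ.
by rewrite mulrA signb_sq cnorm_cyc_inv // natrM; ring.
Qed.

Lemma dnorm_nil F : dnorm F [::] = 0.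
Proof. exact: cnorm_nil. Qed.

Lemma iter_trot_homog n m f : homog m f -> homog m (iter n (@trot k V) f).
Proof.
move=> fm; elim: n => //= n IH [|x w]; first exact: (IH [::]).
rewrite trot_cons mulf_eq0 negb_or => /andP[_ /IH <-].
by rewrite wdeg_rcons wdeg_cons addrC.
Qed.

Lemma cnorm_homog m f w : homog m f -> cnorm f w != 0 -> wdeg w = m.
Proof.
move=> fm nz; have [//|wm] := eqVneq (wdeg w) m; case/eqP: nz.
apply: big1 => a _; rewrite -iter_trotE; apply: (homog_eq0 _ wm).
exact: iter_trot_homog.
Qed.

Lemma cnorm_multilinear f : multilinear (cnorm f : word -> k^o).
Proof.
move=> u v i a x y.
have E (z : V i) : cnorm f (u ++ lett z :: v) =
    \sum_(a < (size u + size v).+1) iter a (@trot k V) f (u ++ lett z :: v).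
  rewrite /cnorm size_cat /= addnS; apply: eq_bigr => j _; exact/esym/iter_trotE.
rewrite !E scaler_sumr -big_split; apply: eq_bigr => j _.
by case: (tensP (iter j (@trot k V) f)) => ->.
Qed.

Lemma symm_homog m f : homog m f -> homog m ((-1) ^+ b *: tstar f + f).
Proof. by move=> fm; apply: homog_lin => //; apply: tstar_homog. Qed.

Lemma dnorm_homog m f w : homog m f -> dnorm f w != 0 -> wdeg w = m.
Proof.
move=> fm; exact: (@cnorm_homog m ((-1) ^+ b *: tstar f + f) w (symm_homog fm)).
Qed.

Lemma dnorm_tens m f : homog m f -> tens_mem (dnorm f : word -> k^o).
Proof.
move=> fm; split; last by apply: findegs_homog => w; apply: dnorm_homog fm.
exact: (@cnorm_multilinear ((-1) ^+ b *: tstar f + f)).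
Qed.

(** Division by the orders [2 n] of the dihedral groups, which inverts the norm
  on invariants. In arity [0] the factor is [0^-1 = 0]. *)
Fact average_subproof f :
  tens_mem (fun w => (2 * size w)%:R^-1 * f w : k^o).
Proof.
have [fl [D fD]] := tensP f; split; last first.
  by exists D => w; rewrite mulf_eq0 negb_or => /andP[_ /fD].
have := multilinear_degs (fun s => (2 * size s)%:R^-1) fl.
by congr multilinear; apply/funext => w; rewrite size_map.
Qed.
Definition average f : tens := mktens (average_subproof f).
Lemma averageE f w : average f w = (2 * size w)%:R^-1 * f w.
Proof. by []. Qed.

Lemma average_homog m f : homog m f -> homog m (average f).
Proof. by move=> fm w; rewrite averageE mulf_eq0 negb_or => /andP[_ /fm]. Qed.

Hypothesis char0 : [pchar k] =i pred0.

Lemma order_neq0 n : (0 < n)%N -> (2 * n)%:R != 0 :> k.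
Proof. by move=> n0; have /pcharf0P -> := char0; rewrite -lt0n muln_gt0 n0. Qed.

Lemma dnorm_average f w : f [::] = 0 -> cyc_inv f ->
  starf f =1 (fun w => (-1) ^+ b * f w) -> dnorm (average f) w = f w.
Proof.
move=> f0 Fc Fs; case: w => [|x w]; first by rewrite dnorm_nil f0.
set W := x :: w; rewrite (eq_dnorm (F' := fun w => (2 * size W)%:R^-1 * f w)); last first.
  by move=> w' ww; rewrite averageE ww.
by rewrite dnormZ dnorm_invariant // mulKf // order_neq0.
Qed.

(** If the norm of [f] vanishes then, in arity [n], [f] is the sum over the group
  of the [g x - x] for the single element [x = - f / (2 n)]. Conversely, the norm
  is invariant under the action. *)
Lemma dih_rel_dnorm m (f : tpos V m) :
  dih_rel b f <-> forall w, dnorm (tposv f) w = 0.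
Proof.
split=> [fr w|f0 n].
  have [x [_ xE]] := fr (size w).
  pose g : tens := \sum_(a < size w) \sum_e (dih_act b a e (x a e) - x a e).
  have -> : dnorm (tposv f) w = dnorm g w.
    apply: eq_dnorm => w' ww; rewrite xE // tens_sumE.
    by apply: eq_bigr => a _; rewrite tens_sumE.
  have dl (h1 h2 : tens) : dnorm (Defs.tval (h1 + h2)) w = dnorm h1 w + dnorm h2 w.
    by have := dnorm_lin 1 h1 h2 w; rewrite mul1r => <-; apply: eq_dnorm => w' _; rewrite mul1r.
  have d0 : dnorm (Defs.tval 0) w = 0.
    by apply: (addrI (dnorm (Defs.tval 0) w)); rewrite -dl !addr0.
  rewrite /g; elim/big_rec: _ => // a h _ IH; rewrite dl IH addr0.
  elim/big_rec: _ => // e h' _ IH'; rewrite dl IH' addr0.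
  have := dnorm_lin (-1) (x a e) (dih_act b a e (x a e)) w.
  rewrite dnorm_dih_act mulN1r addNr => <-.
  by apply: eq_dnorm => w' _; rewrite mulN1r addrC.
have /asboolP[fh fnil] := valP f; rewrite -/(tposv f) in fh fnil.
pose y : tens := - (2 * n)%:R^-1 *: arity_part n (tposv f).
have yE w : size w = n -> y w = - (2 * n)%:R^-1 * tposv f w.
  by move=> wn; rewrite tensZE arity_partE wn eqxx mul1r.
exists (fun _ _ => y); split=> [_ _|w wn].
  split; first by apply/homogZ/arity_part_homog.
  by move=> w; rewrite tensZE mulf_eq0 negb_or => /andP[_ /arity_part_arity].
case: (posnP n) => [n0|npos].
  by move: wn; rewrite n0 => /size0nil ->; rewrite big_ord0 fnil.
have sumE : \sum_(a < n) \sum_e dih_act b a e y w = 0.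
  rewrite -wn -dnorm_orbit_sum (eq_dnorm (F' := fun w => - (2 * n)%:R^-1 * tposv f w)).
    by rewrite dnormZ f0 mulr0.
  by move=> w' ww; rewrite yE // ww.
under eq_bigr => a _ do under eq_bigr => e _ do rewrite tensD tensN.
under eq_bigr => a _ do rewrite big_split.
rewrite big_split /= sumE add0r !sumr_const card_ord card_bool yE //.
by rewrite mulNr opprK -mulrnA -[RHS]mulr_natl mulrA divff ?mul1r // order_neq0.
Qed.

End DihedralNorm.

(** * The isomorphism of complexes *)

Lemma quot_lift (k : fieldType) (M N : lmodType k) (S : submodule M) (T : M -> N) :
  linear T -> (forall x, smem S x -> T x = 0) ->
  exists g : {linear quotm S -> N}, forall x, g (qproj S x) = T x.
Proof.
move=> Tl T0.
have rep (c : quotm S) : exists y, forall x, qproj S x = c -> T x = y.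
  have [x xc] := qproj_surj c; exists (T x) => x' x'c; apply/eqP.
  rewrite -subr_eq0 addrC -scaleN1r -Tl scaleN1r addrC; apply/eqP/T0/qprojP.
  by rewrite x'c.
pose h c := projT1 (cid (rep c)).
have hE x : h (qproj S x) = T x by rewrite /h; case: cid => y /= /(_ x erefl).
have hl : linear h.
  move=> a c c'; have [x <-] := qproj_surj c; have [x' <-] := qproj_surj c'.
  rewrite -[a *: qproj S x]/(qscale a (qproj S x)) qprojZ -qprojD !hE; exact: Tl.
by have [g gE] := linear_packed hl; exists g => x; rewrite gE hE.
Qed.

(** By linearity, the signs which suspensions introduce in a differential can be
  taken out of [h]. For abstract complexes the components of the suspensions
  are used without being unfolded. *)
Lemma susp_commute (k : fieldType) n n' (C D : tgraded k)
    (dC : differential C) (dD : differential D) i j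
    (f : {linear C (i + n + n') -> D i}) (h : {linear C (j + n + n') -> D j}) x :
  sg k (n + n') *: h (dmap dC (i + n + n') (j + n + n') x) = dmap dD i j (f x) ->
  h (dmap (susp_diff n (susp_diff n' dC)) i j x) = dmap dD i j (f x).
Proof.
move=> <-; rewrite sgD -scalerA -[sg k n' *: _]linearZ -linearZ.
by congr (h _); rewrite linearZ.
Qed.

Section Locality.
Variables (k : fieldType) (V : inv_graded k).
Local Notation tens := (tens V).
Local Notation letter := (letter V).
Local Notation word := (seq letter).
Local Notation sg := (sg k).
Implicit Types (F : word -> k).

Lemma iter_rotf_local n w : exists u, forall F, F u = 0 -> iter n (@rotf k V) F w = 0.
Proof.
elim: n w => [|n IH] w; first by exists w.
case: w => [|x w] /=; first by have [u Hu] := IH [::]; exists u.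
by have [u Hu] := IH (rcons w x); exists u => F /Hu ->; rewrite mulr0.
Qed.

Lemma cnorm_local w : exists S : seq word, forall F,
  (forall u, u \in S -> F u = 0) -> cnorm F w = 0.
Proof.
have [u Hu] := choice (fun a => iter_rotf_local a w).
exists [seq u a | a <- iota 0 (size w)] => F F0; apply: big1 => a _.
by apply/Hu/F0/mapP; exists (a : nat); rewrite ?mem_iota ?add0n ?ltn_ord.
Qed.

Lemma dnorm_local b w : exists S : seq word, forall F,
  (forall u, u \in S -> F u = 0) -> dnorm b F w = 0.
Proof.
have [S HS] := cnorm_local w.
exists (S ++ [seq rev (map (@lstar k V) u) | u <- S]) => F F0; apply: HS => u uS.
rewrite /symm /starf !F0 ?mulr0 ?addr0 // mem_cat ?uS //.
by apply/orP; right; apply/mapP; exists u.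
Qed.

Variables (d : int) (B : sym_form V d).
Hypothesis nondeg : nondegenerate_form B.

(** In [g (u ++ h v :: t)] the functional of the letter [h v] is the pairing with
  a vector [y] which depends on [g], [u], [v], [t] only, so that this value is
  the value of the Hamiltonian at [v y], up to sign. *)
Lemma derivation_local p (g : tens) w : exists S : seq word, forall xi,
  is_derivation p xi -> (forall u, u \in S -> ham B p xi u = 0) -> xi g w = 0.
Proof.
have rep (u v t : word) : exists y, forall z, ldeg z = wdeg v - p -> g (u ++ z :: t) = lpair B z y.
  have [y _ yE] := lpair_representr nondeg (1 - (wdeg v - p)) (tens_slot g u t).
  by exists y => z zv; apply: yE; rewrite -zv /ldeg; ring.
pose Y (u v t : word) := projT1 (cid (rep u v t)).
have YE (u v t : word) z : ldeg z = wdeg v - p -> g (u ++ z :: t) = lpair B z (Y u v t).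
  by rewrite /Y; case: cid => y /= yE; exact: yE.
have [S HS] := deconc_support (fun u r =>
  [seq rcons (take j r) (Y u (take j r) (drop j r)) | j <- iota 0 (size r).+1]) w.
exists S => xi D xi0; have [h hE] := derivation_has_data nondeg D.
rewrite (derivation_extE nondeg D hE) extE -[RHS](deconc0 _ w).
apply: eq_deconc => u r ur; rewrite -[RHS](deconc0 _ r); apply: eq_deconc => v t vt.
rewrite (YE u v t) ?dd_deg // -hE.
have /xi0 : rcons v (Y u v t) \in S.
  apply: (HS u r ur); apply/mapP; exists (size v).
    by rewrite mem_iota add0n ltnS -vt size_cat /= leq_addr.
  by rewrite -vt take_size_cat ?drop_size_cat.
rewrite ham_rcons => /eqP; rewrite mulf_eq0 (negbTE (sg_neq0 _ _)) => /eqP ->.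
by rewrite mulr0.
Qed.

End Locality.

Section Complexes.
Variables (k : fieldType) (char0 : [pchar k] =i pred0).
Variables (V : inv_graded k) (d : int) (B : sym_form V d).
Hypothesis nondeg : nondegenerate_form B.
Variables (m : cyc_inv_Ainf B) (b : bool).
Local Notation tens := (tens V).
Local Notation letter := (letter V).
Local Notation word := (seq letter).
Local Notation sg := (sg k).
Local Notation mu := (derv (ainf m)).
Local Notation ham := (ham B).
Local Notation dnorm := (dnorm b).
Local Notation dih_rels i := (Submodule (@dih_rel0 k V b i) (@dih_relP k V b i)).

Lemma cycl_derP c p (xi : cycl_der B c p) : cycl_der_mem B c p (derv xi).
Proof. exact: asboolW (valP xi). Qed.

Lemma mk_cycl_der c p xi : cycl_der_mem B c p xi ->
  exists x : cycl_der B c p, derv x = xi.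
Proof. by move=> H; exists (Sub xi (asboolT H)). Qed.

Lemma derv_inj c p : injective (@derv k V d B c p).
Proof. exact: val_inj. Qed.

Lemma dervP c p (a : k) (xi eta : cycl_der B c p) f :
  derv (a *: xi + eta) f = a *: derv xi f + derv eta f.
Proof.
have valD : derv (a *: xi + eta) = a *: derv xi + derv eta.
  exact: (linearP (\val : cycl_der B c p -> (tens -> tens))).
by rewrite valD opE.
Qed.

Lemma derv0 c p f : derv (0 : cycl_der B c p) f = 0.
Proof. by []. Qed.

Lemma tposP n (f : tpos V n) : tpos_mem n (tposv f).
Proof. exact: asboolW (valP f). Qed.

Lemma mk_tpos n (f : tens) : tpos_mem n f -> exists g : tpos V n, tposv g = f.
Proof. by move=> H; exists (Sub f (asboolT H)). Qed.

Lemma tposv_inj n : injective (@tposv k V n).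
Proof. exact: val_inj. Qed.

Lemma mu_derivation : is_derivation 1 mu.
Proof. by case: (cycl_derP (ainf m)). Qed.

Lemma mu_dstar : dstar mu = mu.
Proof. by case: (cycl_derP (ainf m)) => _ _ ->; rewrite scale1r. Qed.

Lemma mu_tstar f : tstar (mu f) = mu (tstar f).
Proof. by rewrite -[in RHS]mu_dstar /dstar tstarK. Qed.

Lemma mu_cyc_inv : cyc_inv (ham 1 mu).
Proof. by case: (cycl_derP (ainf m)) => _ C _; apply: ham_cyc_inv. Qed.

(** The word [::] has the empty factors only, where [mu] is reduced. *)
Lemma mu_pos n f : tpos_mem n f -> tpos_mem (n + 1) (mu f).
Proof.
move=> [fn f0]; split; first exact: (der_deg mu_derivation).
have [h hE] := derivation_has_data nondeg mu_derivation.
rewrite (derivation_extE nondeg mu_derivation hE) extE /ext_fun !deconc_nil.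
rewrite wdeg_nil mulr0 sg0 mul1r /=.
have := ainf_reduced m (@arity_part_arity _ _ 1 f).
rewrite (derivation_extE nondeg mu_derivation hE) ext_arity1; last exact: arity_part_arity.
by rewrite arity_partE mul1r.
Qed.

Lemma dnorm_mu (h : derivation_data V 1) f w :
  (forall y v, mu (bfun B y) v = lpair B (h v) y) ->
  dnorm (mu f) w = cnorm (head_der h (dnorm f)) w.
Proof.
move=> hE; pose g : tens := (-1) ^+ b *: tstar f + f.
have -> : dnorm (mu f) w = cnorm (mu g) w.
  apply: eq_cnorm => w' _; rewrite /g (der_linear mu_derivation) -mu_tstar; reflexivity.
by rewrite (derivation_extE nondeg mu_derivation hE) cnorm_ext.
Qed.

(** The norm of [mu f] depends on the norm of [f] only. *)
Lemma dih_rel_mu n n' (f : tpos V n) (g : tpos V n') :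
  tposv g = mu (tposv f) -> dih_rel b f -> dih_rel b g.
Proof.
move=> gE /(dih_rel_dnorm b char0) f0; apply/(dih_rel_dnorm b char0) => w.
have [h hE] := derivation_has_data nondeg mu_derivation.
rewrite gE (dnorm_mu _ _ hE).
apply: etrans (cnorm0 w); apply: eq_cnorm => w' _.
by rewrite /head_der -[RHS](deconc0 _ w'); apply: eq_deconc => v r _.
Qed.

Lemma induced_diff_exists : exists dC : differential (Dih V b),
  (forall i j (f : tpos V i), exists2 g : tpos V j,
    tposv g = (if j == i + 1 then mu (tposv f) else 0) &
    dmap dC i j (dih_class b f) = dih_class b g).
Proof.
have Tex i j (f : tpos V i) : exists g : tpos V j,
    tposv g = if j == i + 1 then mu (tposv f) else 0.
  apply: mk_tpos; case: eqP => [->|_]; last exact: tpos_mem0.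
  exact/mu_pos/tposP.
pose T i j f := projT1 (cid (Tex i j f)).
have TE i j f : tposv (T i j f) = if j == i + 1 then mu (tposv f) else 0.
  by rewrite /T; case: cid.
have class0 n (f : tpos V n) : dih_rel b f -> dih_class b f = 0.
  move=> fr; have c0 : dih_class b (0 : tpos V n) = 0.
    by apply: (addrI (dih_class b (0 : tpos V n))); rewrite -qprojD !addr0.
  by rewrite -c0; apply/qprojP; rewrite subr0.
have Tlin i j : linear (fun f => dih_class b (T i j f)).
  move=> a f g; have -> : T i j (a *: f + g) = a *: T i j f + T i j g.
    apply: tposv_inj; rewrite tposvP !TE; case: eqP => _; last by rewrite scaler0 addr0.
    by rewrite tposvP (der_linear mu_derivation).
  by rewrite /dih_class qprojD -qprojZ.
have Trel i j f : dih_rel b f -> dih_class b (T i j f) = 0.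
  move=> fr; apply: class0; have := TE i j f; case: eqP => _ TfE.
    exact: dih_rel_mu TfE fr.
  have -> : T i j f = 0 by apply: tposv_inj; rewrite TfE.
  exact: dih_rel0.
pose D i j := projT1 (cid (@quot_lift _ _ _ (dih_rels i) _ (Tlin i j) (@Trel i j))).
have DE i j f : D i j (dih_class b f) = dih_class b (T i j f).
  by rewrite /D; case: cid => g /= ->.
have Dshape i j : j != i + 1 -> forall x, D i j x = 0.
  move=> ij x; have [f <-] := qproj_surj x; apply: (etrans (DE i j f)).
  apply: class0; have -> : T i j f = 0; last exact: dih_rel0.
  by apply: tposv_inj; rewrite TE (negbTE ij).
have Dsq i j l x : D j l (D i j x) = 0.
  have [f <-] := qproj_surj x; apply: (etrans (congr1 (D j l) (DE i j f))).
  apply: (etrans (DE j l (T i j f))); apply: class0.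
  have -> : T j l (T i j f) = 0; last exact: dih_rel0.
  apply: tposv_inj; rewrite !TE; case: (l == _) => //; case: (j == _).
    by apply: tens_eq => w; rewrite ainf_sq.
  by rewrite (lin0 (der_linear mu_derivation)).
exists (@Differential k (dih_coinv V b) D Dshape Dsq) => i j f.
by exists (T i j f); [exact: TE|exact: DE].
Qed.

Lemma ad_mem p (xi : cycl_der B b p) :
  cycl_der_mem B b (p + 1) (bracket 1 p mu (derv xi)).
Proof.
have [D C xs] := cycl_derP xi; have Dm := mu_derivation.
have [hx hxE] := derivation_has_data nondeg D.
have [h hE] := derivation_has_data nondeg Dm.
have Db := bracket_derivation Dm D.
rewrite [p + 1]addrC; split=> //.
  apply: (cyc_inv_cyclic nondeg Db) => u v.
  rewrite !(ham_bracket nondeg D Dm hxE hE (ham_cyc_inv C) mu_cyc_inv).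
  by rewrite (cyc_inv_cnorm _ u v) mulrCA.
have xsE f : dstar (derv xi) f = (-1) ^+ b *: derv xi f by rewrite xs.
rewrite dstar_bracket ?mu_dstar; [|exact: (der_linear D)|exact: (der_linear Dm)].
apply/funext => f; rewrite /bracket !xsE (linZ (der_linear Dm)).
transitivity ((-1) ^+ b *: (mu (derv xi f) - sg (1 * p) *: derv xi (mu f))) => //.
by rewrite scalerBr !scalerA [_ * (-1) ^+ b]mulrC.
Qed.

Lemma ad_diff_exists : exists dD : differential (Der_cycl B b),
  (forall i j (xi : cycl_der B b i),
    derv (dmap dD i j xi) = if j == i + 1 then bracket 1 i mu (derv xi) else 0).
Proof.
have Tex i j (xi : cycl_der B b i) : exists x : cycl_der B b j,
    derv x = if j == i + 1 then bracket 1 i mu (derv xi) else 0.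
  apply: mk_cycl_der; case: eqP => [->|_]; last exact: cycl_der_mem0.
  exact: ad_mem.
pose T i j xi := projT1 (cid (Tex i j xi)).
have TE i j xi : derv (T i j xi) = if j == i + 1 then bracket 1 i mu (derv xi) else 0.
  by rewrite /T; case: cid.
have ml := der_linear mu_derivation.
have Tlin i j : linear (T i j).
  move=> a x y; apply: derv_inj; apply/funext => f; rewrite dervP !TE.
  case: eqP => _; last by rewrite scaler0 addr0.
  rewrite /bracket !dervP ml !scalerBr !scalerDr !scalerA opprD [a * _]mulrC.
  by rewrite addrACA.
pose D i j := projT1 (cid (linear_packed (Tlin i j))).
have DE i j x : D i j x = T i j x by rewrite /D; case: cid => g /= ->.
have Dshape i j : j != i + 1 -> forall x, D i j x = 0.
  by move=> ij x; apply: derv_inj; rewrite DE TE (negbTE ij).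
have Dsq i j l x : D j l (D i j x) = 0.
  apply: derv_inj; apply/funext => f; rewrite !DE TE.
  case: eqP => // lj; rewrite /bracket TE; case: eqP => [ji|_]; last first.
    by rewrite (lin0 ml) scaler0 subr0.
  have xl : linear (derv x) by have [D0 _ _] := cycl_derP x; case: D0.
  rewrite /bracket !(linB ml) !(linZ ml) !ainf_sq sub0r (lin0 xl) scaler0 subr0.
  rewrite ji -!scaleNr -scalerDl -[RHS](scale0r (mu (derv x (mu f)))).
  by congr (_ *: _); rewrite !mul1r sgD -[sg 1]/(-1 : k) mulrN1 opprK addNr.
exists (@Differential k (cycl_der B b) D Dshape Dsq) => i j xi.
by rewrite -TE -DE.
Qed.

Lemma ham_lin p (a : k) (x y : cycl_der B b p) w :
  ham p (derv (a *: x + y)) w = a * ham p (derv x) w + ham p (derv y) w.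
Proof.
case/lastP: w => [|w z]; first by rewrite mulr0 addr0.
by rewrite !ham_rcons dervP tensE mulrDr mulrCA.
Qed.

Lemma ham_zero p w : ham p (derv (0 : cycl_der B b p)) w = 0.
Proof.
by case/lastP: w => // w z; rewrite ham_rcons derv0 tens0E mulr0.
Qed.

Lemma ham_scale p (a : k) (x : cycl_der B b p) w :
  ham p (derv (a *: x)) w = a * ham p (derv x) w.
Proof. by rewrite -[a *: x]addr0 ham_lin ham_zero addr0. Qed.

Lemma ham_derv_inj p (x y : cycl_der B b p) :
  ham p (derv x) =1 ham p (derv y) -> x = y.
Proof.
move=> xy; apply: derv_inj; have [Dx _ _] := cycl_derP x; have [Dy _ _] := cycl_derP y.
exact: ham_inj Dx Dy xy.
Qed.

Lemma ham_derv_surj p (F : tens) : homog (p + (d + 1) + 1) F -> F [::] = 0 ->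
  cyc_inv F -> starf F =1 (fun w => (-1) ^+ b * F w) ->
  exists x : cycl_der B b p, ham p (derv x) =1 F.
Proof.
move=> Fh F0 Fc Fs; have [xi [D C xF]] := ham_surj nondeg Fh F0 Fc.
suff xs : dstar xi = (-1) ^+ b *: xi.
  have xm : cycl_der_mem B b p xi by [].
  by have [x xE] := mk_cycl_der xm; exists x; rewrite xE.
have Ds := dstar_derivation D.
apply: (ham_inj nondeg Ds (derivation_scale _ D)) => w.
rewrite (ham_dstar D (ham_cyc_inv C)).
transitivity (starf F w); first by rewrite /starf xF.
rewrite Fs -xF; case/lastP: w => [|w z]; first exact: mulr0.
by rewrite !ham_rcons -[((-1) ^+ b *: xi) _]/((-1) ^+ b *: xi _) tensZE mulrCA.
Qed.

Lemma tpos_dnorm n (f : tpos V n) : exists g : tens,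
  [/\ g =1 dnorm (tposv f), homog n g, g [::] = 0 & cyc_inv g].
Proof.
have [fn f0] := tposP f; exists (mktens (dnorm_tens b fn)); split=> //.
- by move=> w; apply: dnorm_homog.
- exact: (dnorm_nil b (tposv f)).
- exact: (@cyc_inv_dnorm k V b (tposv f)).
Qed.

(** The norm of a class is invariant under the (skew-)dihedral action, and
  therefore the Hamiltonian of a unique derivation in the eigenspace. *)
Lemma norm_iso p : exists f : {linear Dih V b (p + (d + 1) + 1) -> Der_cycl B b p},
  (forall x, ham p (derv (f (dih_class b x))) =1 dnorm (tposv x)).
Proof.
have Tex (x : tpos V (p + (d + 1) + 1)) : exists y : cycl_der B b p,
    ham p (derv y) =1 dnorm (tposv x).
  have [g [gE gh g0 gc]] := tpos_dnorm x.
  have [|y yE] := ham_derv_surj gh g0 gc.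
    move=> w; transitivity (starf (dnorm (tposv x)) w); first by rewrite /starf gE.
    by rewrite starf_dnorm -gE.
  by exists y => w; rewrite yE gE.
have [T TE] := choice Tex.
have Tlin : linear T.
  move=> a x y; apply: ham_derv_inj => w; rewrite ham_lin !TE tposvP.
  exact: dnorm_tens_lin.
have Trel x : dih_rel b x -> T x = 0.
  move=> /(dih_rel_dnorm b char0) x0; apply: ham_derv_inj => w; rewrite TE x0.
  case/lastP: w => // w z; rewrite ham_rcons; exact/esym/mulr0.
have [g gE] := @quot_lift _ _ _ (dih_rels _) _ Tlin Trel.
by exists g => x w; rewrite [g _]gE TE.
Qed.

Lemma average_pos n (f : tens) : tpos_mem n f -> tpos_mem n (average f).
Proof. by move=> [fn f0]; split; [exact: average_homog|rewrite averageE f0 mulr0]. Qed.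

(** The inverse of [norm_iso] is the class of the average of the Hamiltonian. Both
  maps are continuous since norms and Hamiltonians, at a given word, involve
  finitely many values only. They commute with the differentials because
  [dnorm_mu] and [ham_bracket] have the same right-hand side. *)
Lemma dihedral_complex_iso :
  exists (dC : differential (Dih V b)) (dD : differential (Der_cycl B b)),
    [/\ is_induced_diff m dC, is_ad_diff m dD &
        complex_iso (susp_diff (d + 1) (CD_diff dC)) dD].
Proof.
have [dC dCE] := induced_diff_exists; have [dD dDE] := ad_diff_exists.
exists dC, dD; split.
- by move=> p f; have [g] := dCE p (p + 1) f; rewrite eqxx; exists g.
- by move=> p xi; rewrite dDE eqxx.
pose f (p : int) := projT1 (cid (norm_iso p)).
have fE (p : int) x : ham p (derv (f p (dih_class b x))) =1 dnorm (tposv x).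
  by rewrite /f; case: cid => g /= gE; exact: gE.
have gex p (xi : cycl_der B b p) : exists x : tpos V (p + (d + 1) + 1),
    forall w, tposv x w = (2 * size w)%:R^-1 * ham p (derv xi) w.
  have [D _ _] := cycl_derP xi.
  pose F := mktens (ham_tens B D).
  have [x xE] : exists x : tpos V (p + (d + 1) + 1), tposv x = average F.
    by apply/mk_tpos/average_pos; split=> // w; exact: ham_homog.
  by exists x => w; rewrite xE.
pose avg p xi := projT1 (cid (gex p xi)).
have avgE p xi w : tposv (avg p xi) w = (2 * size w)%:R^-1 * ham p (derv xi) w.
  by rewrite /avg; case: cid.
have favg p xi : f p (dih_class b (avg p xi)) = xi.
  apply: ham_derv_inj => w; rewrite fE.
  have [D C xs] := cycl_derP xi.
  pose F := mktens (ham_tens B D).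
  rewrite (@eq_dnorm _ _ b _ (average F)) => [|w' _]; last by rewrite avgE.
  rewrite dnorm_average //; first exact: ham_cyc_inv C.
  move=> w'; transitivity (starf (ham p (derv xi)) w') => //.
  rewrite -(ham_dstar D (ham_cyc_inv C)) xs.
  case/lastP: w' => [|w' z]; first exact/esym/mulr0.
  rewrite mktensE !ham_rcons.
  by rewrite -[((-1) ^+ b *: derv xi) _]/((-1) ^+ b *: derv xi _) tensZE mulrCA.
exists f, (fun p xi => dih_class b (avg p xi)); split.
- move=> p; split; last exact: favg.
  move=> c; have [x <-] := qproj_surj c; apply/qprojP/(dih_rel_dnorm b char0) => w.
  have := favg p (f p (dih_class b x)).
  move=> /(congr1 (fun xi : cycl_der B b p => ham p (derv xi) w)); rewrite !fE => E.
  have -> : avg p (f p (dih_class b x)) - x = (-1 : k) *: x + avg p (f p (dih_class b x)).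
    by rewrite scaleN1r [RHS]addrC.
  by rewrite tposvP dnorm_tens_lin E mulN1r addNr.
- move=> p; split.
    move=> U [S _ <-].
    have loc (e : tens * word) := derivation_local nondeg p e.1 e.2.
    have dloc w := @dnorm_local k V b w.
    have [T HT] := choice loc; have [T' HT'] := choice dloc.
    pose S' := flatten [seq T' u | u <- flatten [seq T e | e <- S]].
    exists (@dih_class k V b _ @`
      [set x | forall w, w \in S' -> tposv x w = 0])%classic; first by exists S'.
    move=> _ [_ [x x0 <-] <-] e eS; have [D _ _] := cycl_derP (f p (dih_class b x)).
    apply: (HT e _ D) => u uT; rewrite fE; apply: HT' => w wT; apply: x0.
    apply/flatten_mapP; exists u => //; apply/flatten_mapP; by exists e.
  move=> U [S _ <-].
  pose ev (w : word) : tens * word :=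
    if w is x :: t then (bfun B (last x t), belast x t) else (0, [::]).
  exists [set xi : cycl_der B b p | forall e, e \in map ev S -> derv xi e.1 e.2 = 0]%classic.
    by exists (map ev S).
  move=> _ [xi xi0 <-]; exists (avg p xi) => // w wS; rewrite avgE.
  have := xi0 (ev w) (map_f ev wS); case: w {wS} => [|y t] /= E; first exact: mulr0.
  by rewrite E !mulr0.
move=> i j c; have [x <-] := qproj_surj c; rewrite -/(dih_class b x).
have [g gE dg] := dCE (i + (d + 1) + 1) (j + (d + 1) + 1) x.
apply: (@susp_commute k (d + 1) 1 (Dih V b) (Der_cycl B b) dC dD i j (f i) (f j)).
rewrite dg; apply: ham_derv_inj => w; rewrite ham_scale fE gE dDE.
have -> : (j + (d + 1) + 1 == i + (d + 1) + 1 + 1) = (j == i + 1).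
  by apply/eqP/eqP => ?; lia.
have [->|_] := eqVneq j (i + 1); last first.
  rewrite (dnorm_tens0 b w) !mulr0; case/lastP: w => // w z.
  by rewrite ham_rcons; exact/esym/mulr0.
have [D C _] := cycl_derP (f i (dih_class b x)); have Dm := mu_derivation.
have [hx hxE] := derivation_has_data nondeg D.
have [h hE] := derivation_has_data nondeg Dm.
rewrite (dnorm_mu _ _ hE) [i + 1]addrC.
rewrite (ham_bracket nondeg D Dm hxE hE (ham_cyc_inv C) mu_cyc_inv).
congr (_ * _); first by parity.
apply: eq_cnorm => w' _; apply: eq_deconc => v r _; exact/esym/fE.
Qed.

End Complexes.

Theorem theorem3p19 (k : fieldType) (char0 : [pchar k] =i pred0)
    (V : inv_graded k) (d : int) (B : sym_form V d) (nondeg : nondegenerate_form B)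
    (m : cyc_inv_Ainf B) :
  (exists (dC : differential (Dih V false)) (dD : differential (Der_cycl B false)),
     [/\ is_induced_diff m dC, is_ad_diff m dD &
         complex_iso (susp_diff (d + 1) (CD_diff dC)) dD]) /\
  (exists (dC : differential (Dih V true)) (dD : differential (Der_cycl B true)),
     [/\ is_induced_diff m dC, is_ad_diff m dD &
         complex_iso (susp_diff (d + 1) (CD_diff dC)) dD]).
Proof. by split; apply: dihedral_complex_iso. Qed.
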